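(* Let $q\geq 5$ be a prime power with $q\equiv 2\pmod 3$ and let $P\in\mathcal O$ be a point of $\mathcal X_3$. Then the Weierstrass semigroup at $P$ is $H(P)=\langle q-2,\,q,\,q+1\rangle$.
   Context: Let $q$ be a prime power with $q\equiv 2\pmod 3$ and put $m=(q+1)/3$. Let $\mathcal X_3$ be the nonsingular projective model (defined over $\mathbb F_{q^2}$) of the plane curve $y^{q+1}+x^{2m}+x^m=0$; its function field is $\mathbb F_{q^2}(x,y)$ with this relation. There are exactly $m$ points of $\mathcal X_3$ centered at the singular point $(0,0)$ (the zeros of $x$); call this set $\mathcal O_0$. There are exactly $m$ points lying over the point at infinity of the plane curve (the poles of $x$); call this set $\mathcal O_\infty$. Every other point has affine coordinates $(a,b)$ with $a\neq 0$ and is denoted $P_{(a,b)}$. Let $\mathcal O_m=\{P_{(a,0)} : a^m+1=0\}$ and $\mathcal O=\mathcal O_0\cup\mathcal O_\infty\cup\mathcal O_m$. For a point $P$, the Weierstrass semigroup $H(P)$ is the set of integers $n\geq 0$ for which there is a function $f$ on $\mathcal X_3$ with pole divisor exactly $nP$; $\langle\cdot\rangle$ denotes the numerical semigroup generated by the listed integers. *)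

(* Defs.v *)
From HB Require Import structures.
From mathcomp Require Import all_boot all_order all_algebra all_field.
Set Implicit Arguments. Unset Strict Implicit. Unset Printing Implicit Defensive.
Import Order.TTheory GRing.Theory Num.Theory.
Local Open Scope ring_scope.

Section Defs.
Variables (K F : fieldType) (iota : {rmorphism K -> F}).

Definition eval2 (A : {poly {poly K}}) (x y : F) : F :=
  \sum_(i < size A) (map_poly iota A`_i).[x] * y ^+ i.

Definition transcendental (x : F) : Prop :=
  forall p : {poly K}, p != 0 -> (map_poly iota p).[x] != 0.

Definition is_X3_function_field (q : nat) (x y : F) : Prop :=
  let m := ((q + 1) %/ 3)%N in
  [/\ y ^+ (q + 1) + x ^+ (2 * m) + x ^+ m = 0,
      transcendental x &
      forall z : F, exists A B : {poly {poly K}},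
        eval2 B x y != 0 /\ z = eval2 A x y / eval2 B x y].

(* A place (point of the nonsingular model) of F/K, given by its normalized
   discrete valuation v (values on nonzero elements; v 0 is irrelevant). *)
Definition is_place (v : F -> int) : Prop :=
  [/\ (forall a b, a != 0 -> b != 0 -> v (a * b) = v a + v b),
      (forall a b, a != 0 -> b != 0 -> a + b != 0 ->
          Num.min (v a) (v b) <= v (a + b)),
      (forall c : K, c != 0 -> v (iota c) = 0) &
      (exists t, t != 0 /\ v t = 1)].

Definition same_place (v w : F -> int) : Prop :=
  forall z, z != 0 -> v z = w z.

Definition in_weierstrass (P : F -> int) (n : nat) : Prop :=
  exists f : F, [/\ f != 0, P f = - (n%:Z) &
    forall Q, is_place Q -> ~ same_place Q P -> 0 <= Q f].

Definition in_O (q : nat) (x y : F) (P : F -> int) : Prop :=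
  let m := ((q + 1) %/ 3)%N in
  [\/ 0 < P x,
      P x < 0
    | exists a : K, a ^+ m = -1 /\ 0 < P (x - iota a) /\ 0 < P y ].

End Defs.

Definition in_semigroup3 (g1 g2 g3 n : nat) : Prop :=
  exists a b c : nat, n = (a * g1 + b * g2 + c * g3)%N.

(* Main.v *)
(* Put w = y^3 / x. The curve becomes the cubic cover y^3 = x w of the Fermat curve
   x^m + w^m + 1 = 0, and the symmetries of the latter reduce every point of O to one
   over x = 0, where w takes a value b with b^m = -1. The line w = b is an inflectional
   tangent there, so (w - b)^-1, y / (w - b), x / (w - b) have their only pole at P, of
   orders q + 1, q, q - 2.
   Conversely these three functions generate a ring A over K with fraction field F. If f
   is not in A, a maximal ideal M of A containing the conductor {s | s f in A} has a
   discrete valuation ring as its local ring, by smoothness; this gives a place other than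
   P at which f has a pole. Residue fields are handled without choosing points: for a
   power N of |K| every z in A satisfies z^N = z modulo M, so z^N - z plays the part of
   z - z(M). Thus f is in A, and the monomials x^i y^j / (w - b)^(i+j+d) with i < m, j < 3
   span A and have pairwise distinct orders at P. *)
Require Import Defs.
From HB Require Import structures.
From mathcomp Require Import all_boot all_order all_algebra all_field.
From mathcomp Require Import zify ring.
From mathcomp Require boolp classical_sets.
Set Implicit Arguments. Unset Strict Implicit. Unset Printing Implicit Defensive.
Import Order.TTheory GRing.Theory Num.Theory.
Local Open Scope ring_scope.

(** * Subalgebras and the calculus of valuations *)

Section Places.
Variables (K F : fieldType) (iota : {rmorphism K -> F}).

Definition subalg (S : F -> Prop) : Prop :=
  [/\ forall c, S (iota c),
      forall a b, S a -> S b -> S (a + b) &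
      forall a b, S a -> S b -> S (a * b)].

Section Subalg.
Variables (S : F -> Prop) (hS : subalg S).

Lemma subalgC c : S (iota c). Proof. by case: hS. Qed.
Lemma subalgD a b : S a -> S b -> S (a + b). Proof. by case: hS => _ + _; apply. Qed.
Lemma subalgM a b : S a -> S b -> S (a * b). Proof. by case: hS => _ _; apply. Qed.
Lemma subalg0 : S 0. Proof. by rewrite -(rmorph0 iota); apply: subalgC. Qed.
Lemma subalg1 : S 1. Proof. by rewrite -(rmorph1 iota); apply: subalgC. Qed.
Lemma subalgN a : S a -> S (- a).
Proof.
move=> Sa; have -> : - a = iota (-1) * a by rewrite rmorphN1 mulN1r.
by apply: subalgM => //; apply: subalgC.
Qed.
Lemma subalgB a b : S a -> S b -> S (a - b).
Proof. by move=> Sa Sb; apply: subalgD => //; apply: subalgN. Qed.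
Lemma subalgX a n : S a -> S (a ^+ n).
Proof.
move=> Sa; elim: n => [|n IH]; first by rewrite expr0; apply: subalg1.
by rewrite exprS; apply: subalgM.
Qed.
Lemma subalg_nat n : S n%:R.
Proof. by rewrite -(rmorph_nat iota); apply: subalgC. Qed.
Lemma subalg_horner (g : {poly K}) a : S a -> S (map_poly iota g).[a].
Proof.
move=> Sa; elim/poly_ind: g => [|g c IH]; first by rewrite rmorph0 horner0; apply: subalg0.
rewrite rmorphD rmorphM /= map_polyX map_polyC hornerMXaddC.
by apply: subalgD (subalgC _); apply: subalgM.
Qed.
End Subalg.

Section OnePlace.
Variables (v : F -> int) (vP : is_place iota v).

(** [is_place] leaves [v 0] arbitrary; the first disjunct gives 0 infinite valuation, so that these
    sets are closed under addition. *)
Definition vge (n : int) (z : F) : Prop := z = 0 \/ n <= v z.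

Lemma placeM a b : a != 0 -> b != 0 -> v (a * b) = v a + v b.
Proof. by case: vP => + _ _ _; apply. Qed.

Lemma placeC c : c != 0 -> v (iota c) = 0.
Proof. by case: vP => _ _ + _; apply. Qed.

Lemma place1 : v 1 = 0.
Proof. by rewrite -(rmorph1 iota) placeC ?oner_eq0. Qed.

Lemma placeX a n : a != 0 -> v (a ^+ n) = n%:Z * v a.
Proof.
move=> a0; elim: n => [|n IH]; first by rewrite expr0 place1 mul0r.
by rewrite exprS placeM ?expf_neq0 // IH; lia.
Qed.

Lemma placeV a : a != 0 -> v a^-1 = - v a.
Proof.
move=> a0; have := place1; rewrite -(divff a0) placeM ?invr_neq0 //; lia.
Qed.

Lemma placeN a : a != 0 -> v (- a) = v a.
Proof.
move=> a0; rewrite -mulN1r placeM ?oppr_eq0 ?oner_eq0 //.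
by rewrite -(rmorphN1 iota) placeC ?oppr_eq0 ?oner_eq0 // add0r.
Qed.

Lemma vge_neq0 n a : a != 0 -> vge n a -> n <= v a.
Proof. by move=> /eqP a0 []. Qed.

Lemma vgeW i j a : j <= i -> vge i a -> vge j a.
Proof. by move=> ij [|?]; [left | right; lia]. Qed.

Lemma vgeD n a b : vge n a -> vge n b -> vge n (a + b).
Proof.
move=> [-> | va]; first by rewrite add0r.
move=> [-> | vb]; first by rewrite addr0; right.
have [->|a0] := eqVneq a 0; have [->|b0] := eqVneq b 0; rewrite ?addr0 ?add0r.
- by left.
- by right.
- by right.
have [->|ab0] := eqVneq (a + b) 0; first by left.
by right; case: vP => _ /(_ a b a0 b0 ab0) + _ _; rewrite ge_min => /orP[]; exact: le_trans.
Qed.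

Lemma vgeM i j a b : vge i a -> vge j b -> vge (i + j) (a * b).
Proof.
have [->|a0] := eqVneq a 0; first by rewrite mul0r; left.
have [->|b0] := eqVneq b 0; first by rewrite mulr0; left.
move=> /(vge_neq0 a0) va /(vge_neq0 b0) vb; right; rewrite placeM //; lia.
Qed.

Lemma vgeC c : vge 0 (iota c).
Proof.
have [->|c0] := eqVneq c 0; first by rewrite rmorph0; left.
by right; rewrite placeC.
Qed.

Lemma vge_subalg : subalg (vge 0).
Proof. by split; [apply: vgeC | apply: vgeD | move=> a b ha hb; apply: (vgeM ha hb)]. Qed.

Lemma vgeN n a : vge n a -> vge n (- a).
Proof.
have [->|a0] := eqVneq a 0; first by rewrite oppr0.
by move=> /(vge_neq0 a0) va; right; rewrite placeN.
Qed.

Lemma vgeB n a b : vge n a -> vge n b -> vge n (a - b).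
Proof. by move=> ha hb; apply: vgeD => //; apply: vgeN. Qed.

Lemma vge1X a n : (0 < n)%N -> vge 1 a -> vge 1 (a ^+ n).
Proof.
case: n => // n _ [-> | va]; first by rewrite expr0n; left.
have [->|a0] := eqVneq a 0; first by rewrite expr0n; left.
by right; rewrite placeX //; nia.
Qed.

Lemma vgeXE a n i : (0 < n)%N -> vge (n%:Z * i) (a ^+ n) -> vge i a.
Proof.
move=> n0; have [->|a0] := eqVneq a 0; first by left.
move/(vge_neq0 (expf_neq0 _ a0)); rewrite placeX // => h; right; nia.
Qed.

Lemma vge1_const c : vge 1 (iota c) -> c = 0.
Proof.
have [//|c0] := eqVneq c 0; case=> [/eqP|]; last by rewrite placeC.
by rewrite fmorph_eq0 (negPf c0).
Qed.

Lemma place_addl a b : a != 0 -> vge (v a + 1) b -> a + b != 0 /\ v (a + b) = v a.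
Proof.
move=> a0 vb; have h : ~ vge (v a + 1) (a + b).
  move=> h; have := vgeB h vb; rewrite addrK => /(vge_neq0 a0); lia.
have ab0 : a + b != 0 by apply/eqP => ab0; apply: h; left.
split=> //; have : vge (v a) (a + b).
  by apply: vgeD; [right | apply: vgeW vb; lia].
move=> /(vge_neq0 ab0) h1.
have : ~ (v a + 1 <= v (a + b)) by move=> h2; apply: h; right.
lia.
Qed.

Lemma place_add_neq a b : a != 0 -> b != 0 -> v a <> v b ->
  a + b != 0 /\ (v (a + b) = v a \/ v (a + b) = v b).
Proof.
move=> a0 b0 nab; have [ab|ab] : v a < v b \/ v b < v a by lia.
  by have [|? ?] := @place_addl a b a0; [right; lia | split => //; left].
rewrite addrC; have [|? ?] := @place_addl b a b0; first by right; lia.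
by split=> //; right.
Qed.

(** Summands of different valuations cannot cancel: each partial sum has the valuation of one of its
    terms, hence differs in valuation from the next term. Pole orders are read off normal forms this
    way. *)
Lemma place_sum_distinct (I : eqType) (r : seq I) (f : I -> F) : uniq r ->
  (forall i j, i \in r -> j \in r -> f i != 0 -> f j != 0 -> v (f i) = v (f j) -> i = j) ->
  \sum_(i <- r) f i = 0 \/
  exists i, [/\ i \in r, f i != 0 & v (\sum_(i <- r) f i) = v (f i)].
Proof.
elim: r => [|a r IH] /=; first by rewrite big_nil; left.
move=> /andP[ar ur] inj; rewrite big_cons.
have [|->|[i [ir fi0 vi]]] := IH ur.
- by move=> i j ir jr; apply: inj; rewrite inE ?ir ?jr orbT.
- rewrite addr0; have [->|fa0] := eqVneq (f a) 0; first by left.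
  by right; exists a; rewrite mem_head.
right; have [fa0|fa0] := eqVneq (f a) 0.
  by exists i; rewrite fa0 add0r inE ir orbT.
have [s0|s0] := eqVneq (\sum_(j <- r) f j) 0.
  by exists a; rewrite s0 addr0 mem_head.
have ne : v (f a) <> v (\sum_(j <- r) f j).
  rewrite vi => e; have ai : a = i by apply: inj; rewrite ?inE ?eqxx ?ir ?orbT.
  by rewrite ai ir in ar.
have [_ [e|e]] := place_add_neq fa0 s0 ne.
  by exists a; rewrite mem_head.
by exists i; rewrite inE ir orbT e.
Qed.

(** At a pole of [a] the leading term dominates: each Horner step multiplies by [a] and adds a
    constant, whose valuation is too large to matter. *)
Lemma place_horner (g : {poly K}) a : a != 0 -> v a < 0 -> g != 0 ->
  (map_poly iota g).[a] != 0 /\ v (map_poly iota g).[a] = (size g).-1%:Z * v a.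
Proof.
move=> a0 va; elim/poly_ind: g => [|g c IH]; first by rewrite eqxx.
rewrite rmorphD rmorphM /= map_polyX map_polyC hornerMXaddC => g0.
have [gz|gz] := eqVneq g 0.
  move: g0; rewrite gz mul0r add0r polyC_eq0 rmorph0 horner0 mul0r add0r => c0.
  by rewrite size_polyC c0 fmorph_eq0 c0 placeC // mul0r.
have [ga0 vg] := IH gz.
have sz : size (g * 'X + c%:P) = (size g).+1 by rewrite size_MXaddC (negPf gz).
have sg : (0 < size g)%N by rewrite size_poly_gt0.
have ha : (map_poly iota g).[a] * a != 0 by rewrite mulf_neq0.
have vv : v ((map_poly iota g).[a] * a) = (size g)%:Z * v a by rewrite placeM // vg; nia.
have [|-> ->] := @place_addl _ (iota c) ha.
  by apply: vgeW (vgeC c); rewrite vv; nia.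
by rewrite sz vv.
Qed.

End OnePlace.
End Places.

(** * Discrete valuation rings and the places they define *)

Section DVR.
Variables (K F : fieldType) (iota : {rmorphism K -> F}).
Variables (L : F -> Prop) (t : F).
Hypothesis hL : subalg iota L.
Hypothesis t0 : t != 0.
(** A nonzero element is a unit or a multiple of [t]; together with [Lti] this makes [L] local with
    maximal ideal [t L]. *)
Hypothesis Lstep : forall z, z != 0 -> L z -> L z^-1 \/ L (z / t).

Definition Lunit u : Prop := [/\ u != 0, L u & L u^-1].

Lemma LunitM u w : Lunit u -> Lunit w -> Lunit (u * w).
Proof.
move=> [u0 Lu Lui] [w0 Lw Lwi]; split; first by rewrite mulf_neq0.
  exact: (subalgM hL).
by rewrite invfM; apply: (subalgM hL).
Qed.

Lemma LunitV u : Lunit u -> Lunit u^-1.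
Proof. by move=> [u0 Lu Lui]; split; rewrite ?invr_neq0 ?invrK. Qed.

(** Dividing by [t] as long as [Lstep] offers it must reach a unit before the [n]-th division. *)
Lemma dvr_step n z : z != 0 -> L z -> ~ L (z / t ^+ n) ->
  exists i u, Lunit u /\ z = t ^+ i * u.
Proof.
elim: n z => [|n IH] z z0 Lz; first by rewrite expr0 divr1.
move=> h; have [Lzi|Lzt] := Lstep z0 Lz; first by exists 0%N, z; rewrite expr0 mul1r.
have [||i [u [hu e]]] := IH (z / t) _ Lzt.
- by rewrite mulf_neq0 ?invr_neq0.
- by move=> h'; apply: h; rewrite exprS invfM mulrA.
by exists i.+1, u; split=> //; rewrite exprS -mulrA -e mulrCA divff // mulr1.
Qed.

Hypothesis Lt : L t.
Hypothesis Lti : ~ L t^-1.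

Lemma Lunit_expz (n : int) : Lunit (t ^ n) -> n = 0.
Proof.
have aux k : ~ L (t ^+ k.+1)^-1.
  move=> h; apply: Lti; have -> : t^-1 = t ^+ k * (t ^+ k.+1)^-1.
    by rewrite exprS invfM mulrCA divff ?expf_neq0 ?mulr1.
  by apply: (subalgM hL) => //; apply: (subalgX hL).
by case: n => [[|k]|k] //= [_ h1 h2]; case: (aux k).
Qed.

Lemma dvr_uniq (n n' : int) u u' : Lunit u -> Lunit u' ->
  t ^ n * u = t ^ n' * u' -> n = n'.
Proof.
move=> hu hu' e; suff : n - n' = 0 by lia.
apply: Lunit_expz; have -> : t ^ (n - n') = u' * u^-1.
  case: hu => u0 _ _; rewrite expfzDr // -invr_expz.
  have tn0 : t ^ n' != 0 by rewrite expfz_neq0.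
  by apply: (mulIf u0); rewrite mulrAC e mulrAC divff // mul1r divfK.
by apply: LunitM => //; apply: LunitV.
Qed.

Hypothesis Lfin : forall z, z != 0 -> L z -> exists n, ~ L (z / t ^+ n).
Hypothesis Lfrac : forall z, exists a b, [/\ L a, L b, b != 0 & z = a / b].

Lemma dvr_factor z : z != 0 -> exists (n : int) u, Lunit u /\ z = t ^ n * u.
Proof.
move=> z0; have [a [b [La Lb b0 e]]] := Lfrac z.
have a0 : a != 0 by apply: contraNneq z0 => a0; rewrite e a0 mul0r.
have [n /(dvr_step a0 La) [i [u [hu ea]]]] := Lfin a0 La.
have [n' /(dvr_step b0 Lb) [j [w [hw eb]]]] := Lfin b0 Lb.
exists (i%:Z - j%:Z), (u / w); split; first by apply: LunitM => //; apply: LunitV.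
by rewrite e ea eb expfzDr // -invr_expz invfM mulrACA.
Qed.

Section Dominating.
Variables (Q : F -> int) (QP : is_place iota Q).
Hypothesis QL : forall z, L z -> vge Q 0 z.
Hypothesis Qt : vge Q 1 t.

Lemma dominating_place_expz (n : int) u : Lunit u -> Q (t ^ n * u) = n * Q t.
Proof.
move=> [u0 Lu Lui].
have Qu : Q u = 0.
  have ui0 : u^-1 != 0 by rewrite invr_neq0.
  have := vge_neq0 u0 (QL Lu); have := vge_neq0 ui0 (QL Lui).
  by rewrite (placeV QP) //; lia.
rewrite (placeM QP) ?expfz_neq0 // Qu addr0.
case: n => n; first exact: (placeX QP).
by rewrite NegzE -invr_expz (placeV QP) ?expf_neq0 // (placeX QP) // mulNr.
Qed.

(** [Q] is normalized: some [t ^ n * u] has value 1, and this value is [n * Q t], so the positive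
    integer [Q t] divides 1. *)
Lemma dominating_place_uniformizer : Q t = 1.
Proof.
have := vge_neq0 t0 Qt; case: QP => _ _ _ [z [z0]].
have [n [u [hu ->]]] := dvr_factor z0.
rewrite dominating_place_expz // => e h.
have n0 : 0 < n by nia.
nia.
Qed.

Lemma dominating_placeE (n : int) u : Lunit u -> Q (t ^ n * u) = n.
Proof. by move=> hu; rewrite dominating_place_expz // dominating_place_uniformizer mulr1. Qed.
End Dominating.

Lemma dominating_place_uniq Q Q' : is_place iota Q -> is_place iota Q' ->
  (forall z, L z -> vge Q 0 z) -> vge Q 1 t ->
  (forall z, L z -> vge Q' 0 z) -> vge Q' 1 t -> same_place Q Q'.
Proof.
move=> hQ hQ' QL Qt Q'L Q't z z0; have [n [u [hu ->]]] := dvr_factor z0.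
by rewrite !dominating_placeE.
Qed.

(** The valuation of [z] is the exponent of [t] in the factorization of [dvr_factor], unique by
    [dvr_uniq]. *)
Lemma dvr_place : exists Q, [/\ is_place iota Q,
  forall z, L z -> vge Q 0 z & forall z, z != 0 -> 0 <= Q z -> L z].
Proof.
have [Q hQ] : {Q : F -> int & forall z, z != 0 ->
    exists u, Lunit u /\ z = t ^ (Q z) * u}.
  apply: (boolp.choice (P := fun z n => z != 0 -> exists u, Lunit u /\ z = t ^ n * u)).
  move=> z; have [->|/dvr_factor [n h]] := eqVneq z 0; first by exists 0.
  by exists n.
have QE (n : int) u : Lunit u -> Q (t ^ n * u) = n.
  move=> hu; have [u0 _ _] := hu.
  have [|u' [hu' e]] := hQ (t ^ n * u); first by rewrite mulf_neq0 ?expfz_neq0.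
  by symmetry; apply: dvr_uniq e.
have L1 : Lunit 1 by split; rewrite ?invr1 ?oner_eq0 //; apply: (subalg1 hL).
have tXL (n : int) : 0 <= n -> L (t ^ n) by case: n => // n _; apply: (subalgX hL).
have Lpos z : L z -> vge Q 0 z.
  have [->|z0] := eqVneq z 0; first by left.
  move=> Lz; right; have [u [hu e]] := hQ z z0.
  have [n /(dvr_step z0 Lz) [i [w [hw ->]]]] := Lfin z0 Lz.
  by have -> := QE i%:Z w hw.
have posL z : z != 0 -> 0 <= Q z -> L z.
  move=> z0 h; have [u [[_ Lu _] ->]] := hQ z z0.
  by apply: (subalgM hL) => //; apply: tXL.
have QM a b : a != 0 -> b != 0 -> Q (a * b) = Q a + Q b.
  move=> a0 b0; have [u [hu ea]] := hQ a a0; have [w [hw eb]] := hQ b b0.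
  rewrite {1}ea {1}eb mulrACA -expfzDr // QE //; exact: LunitM.
exists Q; split=> //; split=> //.
- move=> a b a0 b0 ab0.
  (* The ultrametric inequality comes down to [(c + d) / c = 1 + d / c], which lies in [L] because
     [d / c] has nonnegative exponent. *)
  have sub c d : c != 0 -> d != 0 -> c + d != 0 -> Q c <= Q d -> Q c <= Q (c + d).
    move=> c0 d0 cd0 le.
    have Qci : Q c^-1 = - Q c.
      have := QM c c^-1 c0; rewrite divff // invr_neq0 // => /(_ isT).
      by have := QE 0 1 L1; rewrite expr0z mulr1 => ->; lia.
    have Lq : L ((c + d) / c).
      rewrite mulrDl divff //; apply: (subalgD hL); first exact: (subalg1 hL).
      apply: posL; first by rewrite mulf_neq0 ?invr_neq0.
      by rewrite QM ?invr_neq0 // Qci; lia.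
    have q0 : (c + d) / c != 0 by rewrite mulf_neq0 ?invr_neq0.
    have := vge_neq0 q0 (Lpos _ Lq); rewrite QM ?invr_neq0 // Qci; lia.
  rewrite ge_min; have [le|le] : Q a <= Q b \/ Q b <= Q a by lia.
    by rewrite sub.
  by rewrite (addrC a) sub ?orbT // addrC.
- move=> c c0; have := QE 0 (iota c); rewrite expr0z mul1r; apply.
  by split; rewrite ?fmorph_eq0 // -?fmorphV; apply: (subalgC hL).
- by exists t; split=> //; have := QE 1 1 L1; rewrite mulr1 expr1z.
Qed.

End DVR.

(** * Frobenius powers and the ring generated by [al], [be], [ga] *)

Section Curve.
Variables (K : finFieldType) (F : fieldType) (iota : {rmorphism K -> F}).

(** [#|K|] is a power of the characteristic, which [F] shares; hence raising to the power [#|K| ^ e]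
    is additive on [F]. *)
Lemma pnat_card_exp e : [pchar F].-nat (#|K| ^ e)%N.
Proof.
rewrite pnatX; apply/orP; left.
have [p _ pK] := finPcharP K.
have pF : p \in [pchar F] by rewrite (fmorph_pchar iota).
have -> : #|K| = (p ^ logn p #|K|)%N by exact: (card_pprimeChar pK).
by rewrite pnatX pnatE ?(pcharf_prime pF) // pF.
Qed.

Lemma exprD_card e (a b : F) :
  (a + b) ^+ (#|K| ^ e)%N = a ^+ (#|K| ^ e)%N + b ^+ (#|K| ^ e)%N.
Proof. exact/exprDn_pchar/pnat_card_exp. Qed.

Lemma exprN_card e (a : F) : (- a) ^+ (#|K| ^ e)%N = - a ^+ (#|K| ^ e)%N.
Proof.
apply/eqP; rewrite -addr_eq0 addrC -exprD_card subrr expr0n.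
by rewrite expn_eq0 -leqn0 leqNgt (ltn_trans _ (finNzRing_gt1 K)).
Qed.

Lemma exprB_card e (a b : F) :
  (a - b) ^+ (#|K| ^ e)%N = a ^+ (#|K| ^ e)%N - b ^+ (#|K| ^ e)%N.
Proof. by rewrite exprD_card exprN_card. Qed.

Lemma iota_card e c : iota c ^+ (#|K| ^ e)%N = iota c.
Proof.
by elim: e => [|e IH]; rewrite ?expn0 ?expr1 // expnSr exprM IH -rmorphXn expf_card.
Qed.

Variables (m : nat) (b : K) (al be ga : F).

(** The ring [K[al, be, ga]]; products enter through the generators only, so that an induction meets
    one generator at a time. *)
Inductive affine_ring : F -> Prop :=
| affine_const c : affine_ring (iota c)
| affine_add z1 z2 : affine_ring z1 -> affine_ring z2 -> affine_ring (z1 + z2)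
| affine_al z : affine_ring z -> affine_ring (al * z)
| affine_be z : affine_ring z -> affine_ring (be * z)
| affine_ga z : affine_ring z -> affine_ring (ga * z).

Local Notation A := affine_ring.

Lemma affine_mul z1 z2 : A z1 -> A z2 -> A (z1 * z2).
Proof.
move=> A1 A2; elim: A1 => [c|u w _ IHu _ IHw|u _ IH|u _ IH|u _ IH].
- elim: A2 => [d|u w _ IHu _ IHw|u _ IH|u _ IH|u _ IH].
  + by rewrite -rmorphM; apply: affine_const.
  + by rewrite mulrDr; apply: affine_add.
  + by rewrite mulrCA; apply: affine_al.
  + by rewrite mulrCA; apply: affine_be.
  + by rewrite mulrCA; apply: affine_ga.
- by rewrite mulrDl; apply: affine_add.
- by rewrite -mulrA; apply: affine_al.
- by rewrite -mulrA; apply: affine_be.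
- by rewrite -mulrA; apply: affine_ga.
Qed.

Lemma affine_subalg : subalg iota A.
Proof. by split; [apply: affine_const | apply: affine_add | apply: affine_mul]. Qed.
Let hA := affine_subalg.

Lemma affine_gens : [/\ A al, A be & A ga].
Proof.
have A1 := subalg1 hA.
by split; [rewrite -(mulr1 al); apply: affine_al | rewrite -(mulr1 be); apply: affine_be
  | rewrite -(mulr1 ga); apply: affine_ga].
Qed.

Lemma affine_min (S : F -> Prop) : subalg iota S -> S al -> S be -> S ga ->
  forall z, A z -> S z.
Proof.
move=> hS Sal Sbe Sga z; elim=> [c|u w _ ? _ ?|u _ ?|u _ ?|u _ ?].
- exact: (subalgC hS).
- exact: (subalgD hS).
- exact: (subalgM hS).
- exact: (subalgM hS).
- exact: (subalgM hS).
Qed.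

(** In the application [s = w - b], [al = x / s], [be = y / s], [ga = 1 / s], so [W] is [w / s], and
    the two equations below are those of the curve divided by [s ^ m] and [s ^ 3]. *)
Local Notation W := (1 + iota b * ga).
Hypothesis m0 : (0 < m)%N.
Hypothesis fermat : al ^+ m + W ^+ m + ga ^+ m = 0.
Hypothesis cubic : be ^+ 3 = al * W * ga.

(** Substitution of [ga], packaged as a ring morphism so that integrality over [K[ga]] can be
    expressed. *)
Definition ev : {rmorphism {poly K} -> F} :=
  horner_morph (fun c => mulrC ga (iota c)).

Lemma evE g : ev g = (map_poly iota g).[ga]. Proof. by []. Qed.
Lemma evC c : ev c%:P = iota c. Proof. exact: horner_morphC. Qed.
Lemma evX : ev 'X = ga. Proof. exact: horner_morphX. Qed.

Lemma affine_ev g : A (ev g).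
Proof. by rewrite evE; apply: (subalg_horner hA); case: affine_gens. Qed.

Let Wp : {poly K} := 1 + b%:P * 'X.
Let evW : ev Wp = W.
Proof. by rewrite rmorphD rmorphM rmorph1 /= evC evX. Qed.

Lemma affine_W : A W. Proof. by rewrite -evW; apply: affine_ev. Qed.

Let al_m : al ^+ m = ev (- (Wp ^+ m + 'X^m)).
Proof.
rewrite rmorphN rmorphD !rmorphXn /= evW evX; apply/eqP.
by rewrite -addr_eq0 addrA fermat.
Qed.

Definition normal_form (h : 'I_m * 'I_3 -> {poly K}) : F :=
  \sum_ij ev (h ij) * (al ^+ ij.1 * be ^+ ij.2).

Let NF z := exists h, z = normal_form h.

Let NF_add z1 z2 : NF z1 -> NF z2 -> NF (z1 + z2).
Proof.
move=> [h1 ->] [h2 ->]; exists (fun ij => h1 ij + h2 ij).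
by rewrite -big_split; apply: eq_bigr => ij _; rewrite rmorphD mulrDl.
Qed.

Let NF_mono g i j : (i < m)%N -> (j < 3)%N -> NF (ev g * (al ^+ i * be ^+ j)).
Proof.
move=> im j3; exists (fun ij => if ij == (Ordinal im, Ordinal j3) then g else 0).
rewrite /normal_form (bigD1 (Ordinal im, Ordinal j3)) //= eqxx big1 ?addr0 // => ij /negPf ->.
by rewrite rmorph0 mul0r.
Qed.

Let NF_linear u : (forall g i j, (i < m)%N -> (j < 3)%N -> NF (u * (ev g * (al ^+ i * be ^+ j)))) ->
  forall z, NF z -> NF (u * z).
Proof.
move=> hu z [h ->]; rewrite /normal_form mulr_sumr; elim/big_ind: _ => //.
  by rewrite -(mul0r (al ^+ 0 * be ^+ 0)) -(rmorph0 ev); apply: NF_mono.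
by move=> [i j] _; apply: hu.
Qed.

Let NF_al z : NF z -> NF (al * z).
Proof.
apply: NF_linear => g i j im j3; have -> : al * (ev g * (al ^+ i * be ^+ j)) =
  ev g * (al ^+ i.+1 * be ^+ j) by rewrite exprS; ring.
have [im'|im'] : (i.+1 < m)%N \/ i.+1 = m by lia.
  exact: NF_mono.
rewrite im' al_m mulrA -rmorphM -[be ^+ j]mul1r -(expr0 al).
exact: NF_mono.
Qed.

(** [fermat] turns [al ^ m] into a polynomial in [ga], and [cubic] turns [be ^ 3] into [al] times
    one, so multiplication by a generator preserves the [K[ga]]-span of the monomials in
    [normal_form]. *)
Lemma affine_normal_form z : A z -> exists h, z = normal_form h.
Proof.
elim=> [c|u w _ IHu _ IHw|u _ IH|u _ IH|u _ IH].
- by have := @NF_mono c%:P 0 0 m0 isT; rewrite !expr0 !mulr1 evC.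
- exact: NF_add.
- exact: NF_al.
- apply: NF_linear IH => g i j im j3; have -> : be * (ev g * (al ^+ i * be ^+ j)) =
    ev g * (al ^+ i * be ^+ j.+1) by rewrite exprS; ring.
  have [j3'|j3'] : (j.+1 < 3)%N \/ j.+1 = 3 by lia.
    exact: NF_mono.
  rewrite j3' cubic; have -> : ev g * (al ^+ i * (al * W * ga)) =
    al * (ev (g * Wp * 'X) * (al ^+ i * be ^+ 0)).
    by rewrite !rmorphM /= evW evX expr0; ring.
  exact/NF_al/NF_mono.
- apply: NF_linear IH => g i j im j3.
  by rewrite mulrA -{1}evX -rmorphM; apply: NF_mono.
Qed.

Lemma affine_integral z : A z -> integralOver ev z.
Proof.
have ial : integralOver ev al.
  have mon : 'X^m - (- (Wp ^+ m + 'X^m))%:P \is monic by apply: monicXnsubC.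
  exists ('X^m - (- (Wp ^+ m + 'X^m))%:P) => //.
  rewrite rmorphB /= map_polyXn map_polyC /= rootE !hornerE -al_m ?subrr //.
have iga : integralOver ev ga by rewrite -evX; apply: integral_id.
have ibe : integralOver ev be.
  have icub : integralOver ev (be ^+ 3).
    by rewrite cubic -evW; apply: integral_mul => //; apply: integral_mul => //; apply: integral_id.
  apply: (@integral_root_monic _ _ _ _ ('X^3 - (be ^+ 3)%:P)).
  - exact: monicXnsubC.
  - by rewrite rootE !hornerE subrr.
  - apply/integral_poly => i; rewrite coefB coefXn coefC.
    by apply: integral_sub; [apply: integral_nat | case: ifP => _ //; apply: integral0].
elim=> [c|u w _ ? _ ?|u _ ?|u _ ?|u _ ?].
- by rewrite -evC; apply: integral_id.
- exact: integral_add.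
- exact: integral_mul.
- exact: integral_mul.
- exact: integral_mul.
Qed.

(** * Nonzero prime ideals and the Frobenius congruence modulo them *)

Record prime_ideal (M : F -> Prop) : Prop := PrimeIdeal {
  ideal_sub : forall a, M a -> A a;
  ideal0 : M 0;
  idealD : forall a c, M a -> M c -> M (a + c);
  idealM : forall r a, A r -> M a -> M (r * a);
  ideal1 : ~ M 1;
  ideal_prime : forall a c, A a -> A c -> M (a * c) -> M a \/ M c
}.

Section PrimeIdeals.
Variables (M : F -> Prop) (hM : prime_ideal M).

Lemma idealN a : M a -> M (- a).
Proof. by rewrite -mulN1r => Ma; apply: idealM => //; apply/(subalgN hA)/(subalg1 hA). Qed.

Lemma idealB a c : M a -> M c -> M (a - c).
Proof. by move=> Ma Mc; apply: idealD => //; apply: idealN. Qed.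

Lemma idealMr a r : M a -> A r -> M (a * r).
Proof. by rewrite mulrC => ? ?; apply: idealM. Qed.

Lemma ideal_primeX a n : A a -> M (a ^+ n) -> M a.
Proof.
move=> Aa; elim: n => [|n IH]; first by rewrite expr0 => /(ideal1 hM).
by rewrite exprS => /(ideal_prime hM Aa (subalgX hA n Aa))[].
Qed.

Lemma idealX a n : (0 < n)%N -> M a -> M (a ^+ n).
Proof. by case: n => // n _ Ma; rewrite exprS; apply: idealMr => //; apply: (subalgX hA); apply: (ideal_sub hM). Qed.

Lemma ideal_const c : M (iota c) -> c = 0.
Proof.
have [//|c0 Mc] := eqVneq c 0; case: (ideal1 hM).
have -> : 1 = iota c^-1 * iota c by rewrite -rmorphM mulVf ?rmorph1.
exact: (idealM hM (affine_const _) Mc).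
Qed.

Hypothesis Mnz : exists2 a, M a & a != 0.

(** In a monic equation over [K[ga]] of a nonzero [a] in [M], factors [a] can be cancelled until the
    constant term is nonzero; that term is then a multiple of [a]. *)
Lemma ideal_contains_ev : exists2 g, g != 0 & M (ev g).
Proof.
have [a Ma a0] := Mnz; have Aa := ideal_sub hM Ma.
have [P /monic_neq0 P0 /eqP] := affine_integral Aa.
elim/poly_ind: P P0 => [|P c IH]; first by rewrite eqxx.
rewrite rmorphD rmorphM /= map_polyX map_polyC hornerMXaddC => P0 e.
have {}e : (map_poly ev P).[a] * a + ev c = 0 by [].
have [c0|c0] := eqVneq c 0.
  have P'0 : P != 0 by apply: contraNneq P0 => ->; rewrite c0 mul0r addr0.
  apply: IH => //; move/eqP: e; rewrite c0 (rmorph0 ev) addr0 mulf_eq0 (negPf a0) orbF.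
  by move/eqP.
exists c => //; have -> : ev c = - (map_poly ev P).[a] * a.
  by apply/eqP; rewrite mulNr -addr_eq0 addrC; apply/eqP.
apply: idealM => //; apply: (subalgN hA).
elim/poly_ind: (P) => [|P' d IH']; first by rewrite rmorph0 horner0; apply: (subalg0 hA).
rewrite rmorphD rmorphM /= map_polyX map_polyC hornerMXaddC.
by apply: affine_add (affine_ev d); apply: affine_mul.
Qed.

(* The quotient of the ring by [g(ga)] is finite, so the iterates of the Frobenius
   map at any element repeat modulo the ideal. *)
Lemma ideal_frobenius_period z : A z -> exists2 e, (0 < e)%N & M (z ^+ (#|K| ^ e)%N - z).
Proof.
move=> Az; have [g g0 Mg] := ideal_contains_ev.
have sg (d : {poly K}) : (size (d %% g)%R <= size g)%N by rewrite ltnW // ltn_modp.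
have [h hh] := boolp.choice (fun i => affine_normal_form (subalgX hA (#|K| ^ i)%N Az)).
pose T : finType := {ffun 'I_m * 'I_3 -> 'rV[K]_(size g)}.
pose f (i : 'I_#|T|.+1) : T := [ffun ij => poly_rV (h i ij %% g)].
have /injectivePn [i0 [j0 nij fij]] : ~~ injectiveb f.
  by apply/negP => /injectiveP /leq_card; rewrite card_ord ltnn.
have key (i j : 'I_#|T|.+1) : f i = f j -> M (z ^+ (#|K| ^ i)%N - z ^+ (#|K| ^ j)%N).
  move=> fE; rewrite !hh /normal_form -sumrB; elim/big_ind: _ => //.
  - exact: ideal0 hM.
  - exact: idealD.
  move=> ij _; rewrite -mulrBl -rmorphB /=.
  have : h i ij %% g = h j ij %% g.
    have /ffunP/(_ ij) := fE; rewrite !ffunE => /(congr1 rVpoly).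
    by rewrite !poly_rV_K.
  move=> e; rewrite (divp_eq (h i ij) g) (divp_eq (h j ij) g) e opprD addrACA subrr addr0 -mulrBl.
  have [Aal Abe _] := affine_gens.
  apply: idealMr; last by apply: affine_mul; apply: (subalgX hA).
  by rewrite rmorphM; apply: idealM => //; apply: affine_ev.
wlog lij : i0 j0 nij fij / (i0 < j0)%N.
  move=> wl; have [l|l|e] := ltngtP i0 j0; first exact: (wl i0 j0).
  - by apply: (wl j0 i0) => //; rewrite eq_sym.
  - by move: nij; rewrite -val_eqE /= e eqxx.
exists (j0 - i0)%N; first by rewrite subn_gt0.
have Ad : A (z ^+ (#|K| ^ (j0 - i0))%N - z).
  by apply: (subalgB hA) => //; apply: (subalgX hA).
(* By additivity the difference of the two iterates is the [#|K| ^ i0]-th power of the wanted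
   element, and [M] is prime. *)
apply: (@ideal_primeX _ (#|K| ^ i0)%N) => //.
rewrite exprB_card -exprM -expnD subnK 1?ltnW //; exact: key.
Qed.

Lemma frobenius_iter z e n : A z -> M (z ^+ (#|K| ^ e)%N - z) -> M (z ^+ (#|K| ^ (n * e))%N - z).
Proof.
move=> Az Mz; elim: n => [|n IH]; first by rewrite mul0n expn0 expr1 subrr; apply: ideal0 hM.
have -> : z ^+ (#|K| ^ (n.+1 * e))%N - z =
  (z ^+ (#|K| ^ (n * e))%N - z) ^+ (#|K| ^ e)%N + (z ^+ (#|K| ^ e)%N - z).
  by rewrite exprB_card -exprM -expnD mulSn addnC addrA subrK.
apply: idealD => //; apply: idealX => //.
by rewrite expn_gt0 (ltn_trans _ (finNzRing_gt1 K)).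
Qed.

(** The product of the periods of the three generators is a period of each, and the elements fixed
    modulo [M] by that power of Frobenius form a ring. *)
Lemma ideal_frobenius : exists2 e, (0 < e)%N & forall z, A z -> M (z ^+ (#|K| ^ e)%N - z).
Proof.
have [Aal Abe Aga] := affine_gens.
have [e1 e1_0 M1] := ideal_frobenius_period Aal.
have [e2 e2_0 M2] := ideal_frobenius_period Abe.
have [e3 e3_0 M3] := ideal_frobenius_period Aga.
set e := (e1 * e2 * e3)%N.
have Mal : M (al ^+ (#|K| ^ e)%N - al) by rewrite /e -mulnA mulnC; apply: frobenius_iter.
have Mbe : M (be ^+ (#|K| ^ e)%N - be) by rewrite /e mulnAC; apply: frobenius_iter.
have Mga : M (ga ^+ (#|K| ^ e)%N - ga) by apply: frobenius_iter.
exists e; first by rewrite !muln_gt0 e1_0 e2_0.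
have step u z : A u -> A z -> M (u ^+ (#|K| ^ e)%N - u) -> M (z ^+ (#|K| ^ e)%N - z) ->
    M ((u * z) ^+ (#|K| ^ e)%N - u * z).
  move=> Au Az Mu Mz; have -> : (u * z) ^+ (#|K| ^ e)%N - u * z =
    u ^+ (#|K| ^ e)%N * (z ^+ (#|K| ^ e)%N - z) + z * (u ^+ (#|K| ^ e)%N - u).
    by rewrite exprMn; ring.
  by apply: idealD => //; apply: idealM => //; apply: (subalgX hA).
move=> z; elim=> [c|u w Au Mu Aw Mw|u Au Mu|u Au Mu|u Au Mu].
- by rewrite iota_card subrr; apply: ideal0 hM.
- by rewrite exprD_card opprD addrACA; apply: idealD.
- exact: step.
- exact: step.
- exact: step.
Qed.

End PrimeIdeals.
Hypothesis b0 : b != 0.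
Hypothesis mK : m%:R != 0 :> K.
Hypothesis threeK : 3%:R != 0 :> K.
Hypothesis affine_frac : forall z, exists a c, [/\ A a, A c, c != 0 & z = a / c].

(** * Localization at a nonzero prime ideal: smoothness and the resulting place *)

Section Localization.
Variables (M : F -> Prop) (hM : prime_ideal M).
Hypothesis Mnz : exists2 a, M a & a != 0.

Let MA := ideal_sub hM.

Lemma notM_neq0 s : ~ M s -> s != 0.
Proof. by move=> Ms; apply/eqP => s0; apply: Ms; rewrite s0; apply: ideal0. Qed.

Lemma notM_mul a c : A a -> A c -> ~ M a -> ~ M c -> ~ M (a * c).
Proof. by move=> Aa Ac Ma Mc /(ideal_prime hM Aa Ac)[]. Qed.

Lemma notM_cong a c : M (a - c) -> ~ M c -> ~ M a.
Proof. by move=> Mac Mc Ma; apply: Mc; rewrite -(subKr a c); apply: (idealB hM). Qed.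

Lemma notM_nat n a : n%:R != 0 :> K -> A a -> ~ M a -> ~ M (n%:R * a).
Proof.
move=> n0 Aa; apply: notM_mul => //; first exact: (subalg_nat hA).
by rewrite -(rmorph_nat iota) => /(ideal_const hM) n0'; rewrite n0' eqxx in n0.
Qed.

Lemma notM_X a n : A a -> ~ M a -> ~ M (a ^+ n).
Proof. by move=> Aa Ma /(ideal_primeX hM Aa). Qed.

Definition local_ring z := exists a s, [/\ A a, A s, ~ M s & z = a / s].
Local Notation L := local_ring.

Lemma local_affine z : A z -> L z.
Proof. by move=> Az; exists z, 1; split; rewrite ?divr1 //; [apply: (subalg1 hA) | apply: ideal1]. Qed.

Lemma local_inv s : A s -> ~ M s -> L s^-1.
Proof. by move=> As Ms; exists 1, s; split; rewrite ?mul1r //; apply: (subalg1 hA). Qed.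

Lemma local_subalg : subalg iota L.
Proof.
split=> [c|z w [a [s [Aa As Ms ->]]] [c [t [Ac At Mt ->]]]|z w [a [s [Aa As Ms ->]]] [c [t [Ac At Mt ->]]]].
- exact/local_affine/affine_const.
- exists (a * t + c * s), (s * t); split; last by rewrite addf_div ?notM_neq0.
  + by apply: affine_add; apply: affine_mul.
  + exact: affine_mul.
  + exact: notM_mul.
- exists (a * c), (s * t); split; last by rewrite mulf_div.
  + exact: affine_mul.
  + exact: affine_mul.
  + exact: notM_mul.
Qed.
Let hL := local_subalg.

Definition local_dvd t z := exists2 l, L l & z = t * l.
Local Notation T := local_dvd.

Lemma local_dvdxx t : T t t.
Proof. by exists 1; rewrite ?mulr1 //; apply: (subalg1 hL). Qed.

Lemma local_dvdD t z w : T t z -> T t w -> T t (z + w).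
Proof. by move=> [l Ll ->] [k Lk ->]; exists (l + k); rewrite ?mulrDr //; apply: (subalgD hL). Qed.

Lemma local_dvdM t r z : L r -> T t z -> T t (r * z).
Proof. by move=> Lr [l Ll ->]; exists (r * l); rewrite 1?mulrCA //; apply: (subalgM hL). Qed.

Lemma local_dvdAM t r z : A r -> T t z -> T t (r * z).
Proof. by move=> /local_affine; apply: local_dvdM. Qed.

Lemma local_dvd_trans t u z : T t u -> T u z -> T t z.
Proof. by move=> tu [l Ll ->]; rewrite mulrC; apply: local_dvdM. Qed.

Lemma local_dvdN t z : T t z -> T t (- z).
Proof. by rewrite -mulN1r; apply/local_dvdAM/(subalgN hA)/(subalg1 hA). Qed.

Lemma local_dvd_cancel t u z : A u -> ~ M u -> T t (u * z) -> T t z.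
Proof.
move=> Au Mu Tuz; have -> : z = u^-1 * (u * z) by rewrite mulKf ?notM_neq0.
exact/local_dvdM/Tuz/local_inv.
Qed.

(** Since [u] and [w] agree modulo [M], the cofactor reduces to the derivative of [X ^ (n + 1)] at
    [w]; partial derivatives enter the argument here. *)
Lemma subrX_factor u w n : A u -> A w -> M (u - w) ->
  exists c, [/\ A c, u ^+ n.+1 - w ^+ n.+1 = (u - w) * c & M (c - n.+1%:R * w ^+ n)].
Proof.
move=> Au Aw Muw; elim: n => [|n [c [Ac e Mc]]].
  exists 1; split; first exact: (subalg1 hA).
    by rewrite !expr1 mulr1.
  by rewrite expr0 mulr1 subrr; apply: ideal0.
exists (u * c + w ^+ n.+1); split.
- by apply: affine_add; [apply: affine_mul | apply: (subalgX hA)].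
- have -> : u ^+ n.+2 - w ^+ n.+2 = u * (u ^+ n.+1 - w ^+ n.+1) + (u - w) * w ^+ n.+1.
    by rewrite [u ^+ _]exprS [w ^+ n.+2]exprS; ring.
  by rewrite e; ring.
- have -> : u * c + w ^+ n.+1 - n.+2%:R * w ^+ n.+1 =
    u * (c - n.+1%:R * w ^+ n) + n.+1%:R * w ^+ n * (u - w).
    by rewrite -[n.+2]addn1 natrD [w ^+ n.+1]exprS; ring.
  apply: (idealD hM); apply: (idealM hM) => //.
  by apply: affine_mul; [apply: (subalg_nat hA) | apply: (subalgX hA)].
Qed.

Section Uniformizer.
Variables (e : nat) (e0 : (0 < e)%N).
Hypothesis frobM : forall z, A z -> M (z ^+ (#|K| ^ e)%N - z).

Local Notation N := (#|K| ^ e)%N.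
Local Notation D z := (z ^+ (#|K| ^ e)%N - z).

Lemma frob_exp_gt1 : (1 < N)%N.
Proof. by rewrite -(exp1n e) ltn_exp2r // finNzRing_gt1. Qed.

Lemma frob_factor (z : F) : D z = z * (z ^+ N.-1 - 1).
Proof. by rewrite mulrBr mulr1 -exprS prednK // ltnW // frob_exp_gt1. Qed.

(** The element is [-1] modulo [M]. By [frob_factor], [D z] and [z] thus differ by a unit of the
    local ring whenever [z] lies in [M]. *)
Lemma frob_factor_unit (z : F) : M z -> ~ M (z ^+ N.-1 - 1).
Proof.
have hN := frob_exp_gt1; move=> Mz h; apply: (ideal1 hM).
have -> : 1 = z ^+ N.-1 - (z ^+ N.-1 - 1) by rewrite subKr.
by apply: (idealB hM) => //; apply: (idealX hM) => //; lia.
Qed.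

(** A Leibniz rule twisted by Frobenius: with additivity it reduces divisibility of every [D z] by
    [t] to the three generators. *)
Lemma frobD_mul (u w : F) : D (u * w) = u ^+ N * D w + w * D u.
Proof. by rewrite exprMn; ring. Qed.

Lemma local_dvd_frobM t u w : A u -> A w -> T t (D u) -> T t (D w) -> T t (D (u * w)).
Proof.
move=> Au Aw Tu Tw; rewrite frobD_mul; apply: local_dvdD.
  by apply: local_dvdAM => //; apply: (subalgX hA).
exact: local_dvdAM.
Qed.

Lemma frobW : D W = iota b * D ga.
Proof. by rewrite exprD_card exprMn iota_card expr1n; ring. Qed.

Lemma local_dvd_frob_self t z : A z -> T t z -> T t (D z).
Proof.
move=> Az Tz; rewrite frob_factor mulrC; apply: local_dvdAM => //.
by apply: (subalgB hA); [apply: (subalgX hA) | apply: (subalg1 hA)].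
Qed.

Let AN z : A z -> A (z ^+ N). Proof. exact: (subalgX hA). Qed.

Let Aal : A al. Proof. by case: affine_gens. Qed.
Let Abe : A be. Proof. by case: affine_gens. Qed.
Let Aga : A ga. Proof. by case: affine_gens. Qed.
Let AW : A W := affine_W.

Lemma not_ga_W : M ga -> ~ M W.
Proof.
move=> Mga MW; apply: (ideal1 hM); have -> : 1 = W - iota b * ga by ring.
by apply: (idealB hM) => //; apply: (idealM hM) => //; apply: affine_const.
Qed.

(** [al], [W], [ga] are homogeneous coordinates on a Fermat curve: if two of them vanish, so does
    the third, whereas [W - b ga = 1]. *)
Lemma not_al_ga : M al -> ~ M ga.
Proof.
move=> Mal Mga; apply: (not_ga_W Mga); apply: (@ideal_primeX _ hM _ m) => //.
have -> : W ^+ m = - (al ^+ m + ga ^+ m).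
  by apply/eqP; rewrite -addr_eq0 addrC addrAC fermat.
by apply/(idealN hM)/(idealD hM); apply: (idealX hM).
Qed.

Lemma not_al_W : M al -> ~ M W.
Proof.
move=> Mal MW; apply: (not_al_ga Mal); apply: (@ideal_primeX _ hM _ m) => //.
have -> : ga ^+ m = - (al ^+ m + W ^+ m).
  by apply/eqP; rewrite -addr_eq0 addrC fermat.
by apply/(idealN hM)/(idealD hM); apply: (idealX hM).
Qed.

(* Applying the Frobenius to the Fermat equation and subtracting yields a linear relation
   between [D al] and [D ga] whose coefficients are the partial derivatives modulo [M];
   smoothness says that one of them is invertible. *)
Lemma fermat_uniformizer :
  (~ M al /\ T (D ga) (D al)) \/ (M al /\ T (D al) (D ga)).
Proof.
have mE : m = m.-1.+1 by rewrite prednK.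
have [c1 [A1 e1 M1]] := subrX_factor m.-1 (AN Aal) Aal (frobM Aal).
have [c2 [A2 e2 M2]] := subrX_factor m.-1 (AN AW) AW (frobM AW).
have [c3 [A3 e3 M3]] := subrX_factor m.-1 (AN Aga) Aga (frobM Aga).
rewrite -mE in e1 e2 e3 M1 M2 M3.
have fermatN : (al ^+ N) ^+ m + (W ^+ N) ^+ m + (ga ^+ N) ^+ m = 0.
  rewrite -![(_ ^+ N) ^+ m]exprAC -!exprD_card fermat expr0n.
  by have := frob_exp_gt1; case: (N).
have rel : D al * c1 + D ga * (iota b * c2 + c3) = 0.
  have -> : D al * c1 + D ga * (iota b * c2 + c3) = D al * c1 + D W * c2 + D ga * c3.
    by rewrite frobW; ring.
  have eq0 : (al ^+ N) ^+ m + (W ^+ N) ^+ m + (ga ^+ N) ^+ m - (al ^+ m + W ^+ m + ga ^+ m) = 0.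
    by rewrite fermatN fermat subrr.
  by rewrite -e1 -e2 -e3 -[RHS]eq0 2!opprD [RHS]addrACA [X in _ = X + _]addrACA.
have [Mal|Mal] := boolp.EM (M al); [right | left]; split=> //.
  have Ac : A (iota b * c2 + c3) by apply: affine_add => //; apply: affine_mul => //; apply: affine_const.
  apply: (@local_dvd_cancel _ (iota b * c2 + c3)) => //; last first.
    have -> : (iota b * c2 + c3) * D ga = - (c1 * D al).
      by apply/eqP; rewrite -addr_eq0 addrC -rel; apply/eqP; ring.
    by apply/local_dvdN/local_dvdAM/local_dvdxx.
  have AX (z : F) : A z -> A (z ^+ m.-1) by apply: (subalgX hA).
  have AbW : A (iota b * W ^+ m.-1 + ga ^+ m.-1).
    by apply: affine_add; [apply: affine_mul; [apply: affine_const|] |]; apply: AX.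
  apply: (@notM_cong _ (m%:R * (iota b * W ^+ m.-1 + ga ^+ m.-1))).
    have -> : iota b * c2 + c3 - m%:R * (iota b * W ^+ m.-1 + ga ^+ m.-1) =
      iota b * (c2 - m%:R * W ^+ m.-1) + (c3 - m%:R * ga ^+ m.-1) by ring.
    by apply: (idealD hM) => //; apply: (idealM hM) => //; apply: affine_const.
  apply: notM_nat => // h; apply: (not_al_ga Mal); apply: (@ideal_primeX _ hM _ m.-1) => //.
  (* This combines [W = 1 + b ga] with the Fermat equation times [b]; if [al] and the partial
     derivative in brackets both vanished modulo [M], so would [ga]. *)
  have -> : ga ^+ m.-1 = W * (iota b * W ^+ m.-1 + ga ^+ m.-1) + iota b * al ^+ m.
    have eW : W * W ^+ m.-1 = - (al ^+ m + ga * ga ^+ m.-1).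
      rewrite -!exprS -mE; apply/eqP; rewrite -addr_eq0 addrC addrAC; exact/eqP.
    have -> : W * (iota b * W ^+ m.-1 + ga ^+ m.-1) = iota b * (W * W ^+ m.-1) + W * ga ^+ m.-1 by ring.
    rewrite eW; ring.
  apply: (idealD hM); apply: (idealM hM) => //; first exact: affine_const.
  exact: (idealX hM).
apply: (@local_dvd_cancel _ c1) => //.
  by apply: notM_cong M1 _; apply: notM_nat => //; [apply: (subalgX hA) | apply: notM_X].
have -> : c1 * D al = - ((iota b * c2 + c3) * D ga).
  by apply/eqP; rewrite -addr_eq0 -rel; apply/eqP; ring.
apply/local_dvdN/local_dvdAM/local_dvdxx.
by apply: affine_add => //; apply: affine_mul => //; apply: affine_const.
Qed.

(** If [be] is outside [M], so is the derivative [3 be ^ 2], and [cubic] bounds [D be] by the other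
    two differences. Otherwise exactly one of [al], [W], [ga] vanishes modulo [M]; it is [be ^ 3]
    times a unit, so [be] serves as [t], and [fermat_uniformizer] passes divisibility on to the
    remaining difference. *)
Lemma frob_uniformizer : exists2 t, M t & [/\ T t (D al), T t (D be) & T t (D ga)].
Proof.
have [t0 Mt0 [Tal Tga]] : exists2 t, M t & T t (D al) /\ T t (D ga).
  have [[_ h]|[_ h]] := fermat_uniformizer.
    by exists (D ga); [apply: frobM | split=> //; apply: local_dvdxx].
  by exists (D al); [apply: frobM | split=> //; apply: local_dvdxx].
have [Mbe|Mbe] := boolp.EM (M be); last first.
  exists t0 => //; split=> //.
  have [c [Ac ec Mc]] := subrX_factor 2 (AN Abe) Abe (frobM Abe).
  apply: (@local_dvd_cancel _ c) => //.
    by apply: notM_cong Mc _; apply: notM_nat => //; [apply: (subalgX hA) | apply: notM_X].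
  rewrite mulrC -ec exprAC cubic; apply: local_dvd_frobM => //; first exact: affine_mul.
  apply: local_dvd_frobM => //; rewrite frobW; apply: local_dvdAM => //; exact: affine_const.
exists be => //.
have Tfac u w : A u -> A w -> ~ M u -> ~ M w -> forall z, u * w * z = be ^+ 3 -> T be z.
  move=> Au Aw Mu Mw z ez; apply: (@local_dvd_cancel _ (u * w)).
  - exact: affine_mul.
  - exact: notM_mul.
  - by rewrite ez exprS mulrC; apply: local_dvdAM (local_dvdxx _); apply: (subalgX hA).
have Tbe : T be (D be) by apply: local_dvd_frob_self (local_dvdxx _).
have [[Mal Tga']|[Mal Tal']] : (~ M al /\ T (D ga) (D al)) \/ (M al /\ T (D al) (D ga)) := fermat_uniformizer.
  have Mbe3 : M (al * W * ga) by rewrite -cubic; apply: (idealX hM).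
  suff Tga2 : T be (D ga) by split=> //; apply: local_dvd_trans Tga'.
  have AalW : A (al * W) by apply: affine_mul.
  have [MalW|Mga] := ideal_prime hM AalW Aga Mbe3; last first.
    apply: local_dvd_frob_self => //; apply: (Tfac al W) => //; first exact: not_ga_W.
  have [//|MW] := ideal_prime hM Aal AW MalW.
  have Mga : ~ M ga by move=> /not_ga_W.
  (* Here [W] is the vanishing coordinate, and [D ga] is a constant multiple of [D W]. *)
  have -> : D ga = iota b^-1 * D W by rewrite frobW mulrA -rmorphM mulVf // rmorph1 mul1r.
  apply: local_dvdAM; first exact: affine_const.
  apply: local_dvd_frob_self => //; apply: (Tfac al ga) => //.
  by rewrite cubic; ring.
have Tal2 : T be (D al).
  apply: local_dvd_frob_self => //; apply: (Tfac W ga) => //.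
  - exact: not_al_W.
  - exact: not_al_ga.
  - by rewrite cubic; ring.
by split=> //; apply: local_dvd_trans Tal'.
Qed.

(** The [t] of [frob_uniformizer] divides [D z] for all [z] in [A], and for [z] in [M] this [D z] is
    [z] times a unit. *)
Lemma local_uniformizer : exists2 t, M t & forall z, M z -> T t z.
Proof.
have [t Mt [Tal Tbe Tga]] := frob_uniformizer; exists t => //.
have TD z : A z -> T t (D z).
  elim=> [c|u w Au Tu Aw Tw|u Au Tu|u Au Tu|u Au Tu].
  - by rewrite iota_card subrr; exists 0; rewrite ?mulr0 //; apply: (subalg0 hL).
  - by rewrite exprD_card opprD addrACA; apply: local_dvdD.
  - exact: local_dvd_frobM.
  - exact: local_dvd_frobM.
  - exact: local_dvd_frobM.
move=> z Mz; apply: (@local_dvd_cancel _ (z ^+ N.-1 - 1)).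
- by apply: (subalgB hA); [apply/(subalgX hA)/MA | apply: (subalg1 hA)].
- exact: frob_factor_unit.
- by rewrite mulrC -frob_factor; apply/TD/MA.
Qed.

End Uniformizer.

(** With the [t] of [local_uniformizer] the localization meets the hypotheses of [dvr_place]; the
    substantial one is that no nonzero element is divisible by all powers of [t]. *)
Lemma local_place : exists Q, [/\ is_place iota Q,
  forall z, A z -> vge Q 0 z & forall z, z != 0 -> 0 <= Q z -> L z].
Proof.
have [e e0 frobM] := ideal_frobenius hM Mnz.
have [t Mt MT] := local_uniformizer e0 frobM.
have t0 : t != 0.
  apply/eqP => t0; have [a Ma /eqP[]] := Mnz.
  by have [l _ ->] := MT _ Ma; rewrite t0 mul0r.
have At := MA Mt; have Lt := local_affine At.
have Lti : ~ L t^-1.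
  move=> [a [s [Aa As Ms es]]]; apply: Ms; have -> : s = a * t.
    have s0 : s != 0.
      by apply: contraTneq t0 => s0; rewrite -invr_eq0 es s0 invr0 mulr0 eqxx.
    by apply: (mulfI (invr_neq0 s0)); rewrite mulVf // mulrA [_ * a]mulrC -es mulVf.
  exact: idealM.
have step z : z != 0 -> L z -> L z^-1 \/ L (z / t).
  move=> z0 [a [s [Aa As Ms ez]]]; have [Ma|Ma] := boolp.EM (M a).
    right; have [l Ll ea] := MT _ Ma; have -> : z / t = l / s by rewrite ez ea mulrAC [t * l]mulrC mulfK.
    by apply: (subalgM hL) => //; apply: local_inv.
  by left; rewrite ez invf_div; apply: (subalgM hL); [apply: local_affine | apply: local_inv].
have frac z : exists a c, [/\ L a, L c, c != 0 & z = a / c].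
  have [a [c [Aa Ac c0 ez]]] := affine_frac z.
  by exists a, c; split=> //; apply: local_affine.
(* The elements divisible by every power of [t] form a prime ideal [J] strictly inside [M];
   were it nonzero, its Frobenius period would put [t] in [J]. *)
pose J a := A a /\ forall n, L (a / t ^+ n).
have hJ : prime_ideal J.
  split.
  - by move=> a [].
  - by split=> [|n]; rewrite ?mul0r; [apply: (subalg0 hA) | apply: (subalg0 hL)].
  - move=> a c [Aa La] [Ac Lc]; split=> [|n]; first exact: affine_add.
    by rewrite mulrDl; apply: (subalgD hL).
  - move=> r a Ar [Aa La]; split=> [|n]; first exact: affine_mul.
    by rewrite -mulrA; apply: (subalgM hL) => //; apply: local_affine.
  - by move=> [_ /(_ 1%N)]; rewrite div1r.
  - move=> a c Aa Ac [_ Lac]; apply: boolp.contrapT => /boolp.not_orP [Ja Jc].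
    have nz z : A z -> ~ J z -> z != 0 /\ exists n, ~ L (z / t ^+ n).
      move=> Az Jz; split.
        apply/eqP => z0; apply: Jz; rewrite z0; split=> [|n]; first exact: (subalg0 hA).
        by rewrite mul0r; apply: (subalg0 hL).
      by apply/boolp.existsNP => h; apply: Jz.
    have [a0 [n La]] := nz a Aa Ja; have [c0 [k Lc]] := nz c Ac Jc.
    have [i [u [hu ea]]] := dvr_step t0 step a0 (local_affine Aa) La.
    have [j [w [hw ec]]] := dvr_step t0 step c0 (local_affine Ac) Lc.
    have [uw0 Luw Luwi] := LunitM hL hu hw.
    apply: Lti; have -> : t^-1 = a * c / t ^+ (i + j).+1 * (u * w)^-1.
      have tn0 : t ^+ (i + j) != 0 by rewrite expf_neq0.
      rewrite ea ec mulrACA -exprD exprSr.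
      by move: (t ^+ (i + j)) tn0 (u * w) uw0 => ? ? ? ?; field; apply/and3P.
    exact: (subalgM hL).
have fin z : z != 0 -> L z -> exists n, ~ L (z / t ^+ n).
  move=> z0 [a [s [Aa As Ms ez]]]; apply/boolp.existsNP => h.
  have Ja : J a.
    split=> // n; have -> : a / t ^+ n = s * (z / t ^+ n).
      by rewrite ez mulrA [s * _]mulrC divfK // notM_neq0.
    by apply: (subalgM hL) => //; apply: local_affine.
  have a0 : a != 0 by apply: contraNneq z0 => a0; rewrite ez a0 mul0r.
  have [|e' e'0 frobJ] := ideal_frobenius hJ; first by exists a.
  have := frobJ _ At; rewrite frob_factor // => Jt.
  (* Either [t] is in [J], and then [t / t ^ 2] is in [L]; or the cofactor of [t] is in [J], hence
     divisible by [t] and in [M], against [frob_factor_unit]. *)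
  have [|Jtt|[_ /(_ 1%N) [c [r [Ac Ar Mr ec]]]]] := ideal_prime hJ At _ Jt.
  - by apply: (subalgB hA); [apply: (subalgX hA) | apply: (subalg1 hA)].
  - apply: Lti; have [_ /(_ 2)] := Jtt.
    by rewrite expr2 invfM mulrA divff // mul1r.
  - apply: (frob_factor_unit e'0 Mt).
    have er : (t ^+ (#|K| ^ e').-1 - 1) * r = t * c.
      have r0 := notM_neq0 Mr.
      by apply: (mulIf (invr_neq0 t0)); rewrite mulrAC -{1}(expr1 t) ec divfK // mulrAC divff // mul1r.
    have MA' : A (t ^+ (#|K| ^ e').-1 - 1).
      by apply: (subalgB hA); [apply: (subalgX hA) | apply: (subalg1 hA)].
    by have [|//|//] := ideal_prime hM MA' Ar _; rewrite er mulrC; apply: idealM.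
have [Q [QP QL LQ]] := dvr_place hL t0 step Lt Lti fin frac.
by exists Q; split=> // z Az; apply/QL/local_affine.
Qed.

End Localization.

(** * Maximal ideals, and a pole for every function outside the ring *)

Definition proper_ideal (M : F -> Prop) : Prop :=
  [/\ forall a, M a -> A a, forall a c, M a -> M c -> M (a + c),
      forall r a, A r -> M a -> M (r * a) & ~ M 1].

Lemma maximal_ideal_exists (I : F -> Prop) : proper_ideal I ->
  exists M, [/\ proper_ideal M, forall a, I a -> M a &
    forall J : F -> Prop, proper_ideal J -> (forall a, M a -> J a) -> forall a, J a -> M a].
Proof.
(* Zorn's lemma runs over the [X] whose union with [I] is a proper ideal, so that the empty chain,
   whose union stands for [I], is covered. *)
move=> hI; pose P (X : classical_sets.set F) := proper_ideal (fun z => I z \/ X z).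
have [|X [PX maxX]] := @classical_sets.Zorn_bigcup F P.
  move=> FF FP tot.
  have [I1 I2 I3 I4] := hI; split.
  - by move=> a [/I1 //|[X FX Xa]]; have [h _ _ _] := FP X FX; apply: h; right.
  - move=> a c [Ia|[X FX Xa]] [Ic|[Y FY Yc]].
    + by left; apply: I2.
    + have [_ h _ _] := FP Y FY; have [||?|?] := h a c; [by left | by right | by left |].
      by right; exists Y.
    + have [_ h _ _] := FP X FX; have [||?|?] := h a c; [by right | by left | by left |].
      by right; exists X.
    + have [XY|YX] := tot X Y FX FY.
        have [_ h _ _] := FP Y FY; have [||?|?] := h a c; [by right; apply: XY | by right | by left |].
        by right; exists Y.
      have [_ h _ _] := FP X FX; have [||?|?] := h a c; [by right | by right; apply: YX | by left |].
      by right; exists X.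
  - move=> r a Ar [Ia|[X FX Xa]]; first by left; apply: I3.
    have [_ _ h _] := FP X FX; have [//||?|?] := h r a; [by right | by left |].
    by right; exists X.
  - by move=> [//|[X FX X1]]; have [_ _ _ h] := FP X FX; apply: h; right.
exists (fun z => I z \/ X z); split=> // [a Ia|J hJ MJ a Ja]; first by left.
apply: boolp.contrapT => na; apply: (maxX J).
  by split=> [z Xz|JX]; [apply: MJ; right | apply: na; right; apply: JX].
rewrite /P; have -> // : (fun z => I z \/ J z) = J.
by apply/boolp.funext => z; apply/boolp.propext; split=> [[Iz //|//]|]; [apply: MJ; left | right].
Qed.

Lemma maximal_ideal_prime M : M 0 -> proper_ideal M ->
  (forall J : F -> Prop, proper_ideal J -> (forall a, M a -> J a) -> forall a, J a -> M a) ->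
  prime_ideal M.
Proof.
move=> M0 [MA MD MM M1] maxM; split=> // a c Aa Ac Mac.
pose J z := exists r u, [/\ A r, M u & z = u + r * a].
have [[r [u [Ar Mu e]]]|J1] := boolp.EM (J 1).
  right; have -> : c = c * u + r * (a * c) by rewrite -[LHS]mulr1 e; ring.
  by apply: MD; apply: MM.
left; apply: (maxM J).
- split=> //.
  + by move=> _ [r [u [Ar Mu ->]]]; apply: affine_add; [apply: MA | apply: affine_mul].
  + move=> _ _ [r [u [Ar Mu ->]]] [s [w [As Mw ->]]]; exists (r + s), (u + w).
    by split; [apply: affine_add | apply: MD | ring].
  + move=> s _ As [r [u [Ar Mu ->]]]; exists (s * r), (s * u).
    by split; [apply: affine_mul | apply: MM | ring].
- by move=> z Mz; exists 0, z; split; rewrite ?mul0r ?addr0 //; apply: (subalg0 hA).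
- by exists 1, 0; split; rewrite ?mul1r ?add0r //; apply: (subalg1 hA).
Qed.

Lemma affine_pole f : f != 0 -> ~ A f -> exists Q,
  [/\ is_place iota Q, forall z, A z -> vge Q 0 z & Q f < 0].
Proof.
move=> f0 nAf; pose I s := A s /\ A (s * f).
have hI : proper_ideal I.
  split.
  - by move=> a [].
  - by move=> a c [Aa Aaf] [Ac Acf]; split; rewrite ?mulrDl; apply: affine_add.
  - by move=> r a Ar [Aa Aaf]; split; rewrite -?mulrA; apply: affine_mul.
  - by move=> [_]; rewrite mul1r.
have [M [hM IM maxM]] := maximal_ideal_exists hI.
have M0 : M 0 by apply: IM; split; rewrite ?mul0r; apply: (subalg0 hA).
have pM := maximal_ideal_prime M0 hM maxM.
have Mnz : exists2 a, M a & a != 0.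
  have [a [c [Aa Ac c0 e]]] := affine_frac f; exists c => //; apply: IM; split=> //.
  by rewrite e mulrC divfK.
have [Q [QP QA QL]] := local_place pM Mnz; exists Q; split=> //.
(* Were [f] regular at [Q], it would be [a / s] with [s] outside [M]; but such an [s] belongs to the
   conductor [I], which [M] contains. *)
rewrite ltNge; apply/negP => Qf; have [a [s [Aa As Ms e]]] := QL f f0 Qf.
have s0 := notM_neq0 pM Ms.
by apply: Ms; apply: IM; split=> //; rewrite e mulrC divfK.
Qed.

End Curve.

(** * Subfields, and the arithmetic of the pole orders *)

Definition subfield (K F : fieldType) (iota : {rmorphism K -> F}) (S : F -> Prop) : Prop :=
  subalg iota S /\ forall z, S z -> S z^-1.

Lemma subfield_div (K F : fieldType) (iota : {rmorphism K -> F}) (S : F -> Prop) z1 z2 :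
  subfield iota S -> S z1 -> S z2 -> S (z1 / z2).
Proof. by move=> [hS SV] S1 S2; apply: (subalgM hS) => //; apply: SV. Qed.

Lemma fractions_subfield (K F : fieldType) (iota : {rmorphism K -> F}) (S : F -> Prop) :
  subalg iota S ->
  subfield iota (fun z => exists a c, [/\ S a, S c, c != 0 & z = a / c]).
Proof.
move=> hS; split; first split.
- move=> c; exists (iota c), 1; split; rewrite ?oner_eq0 ?divr1 //.
    exact: (subalgC hS).
  exact: (subalg1 hS).
- move=> _ _ [a [c [Sa Sc c0 ->]]] [d [e [Sd Se e0 ->]]].
  exists (a * e + d * c), (c * e); split; rewrite ?mulf_neq0 ?addf_div //.
    by apply: (subalgD hS); apply: (subalgM hS).
  exact: (subalgM hS).
- move=> _ _ [a [c [Sa Sc c0 ->]]] [d [e [Sd Se e0 ->]]].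
  by exists (a * d), (c * e); split; rewrite ?mulf_neq0 ?mulf_div //; apply: (subalgM hS).
- move=> _ [a [c [Sa Sc c0 ->]]]; have [a0|a0] := eqVneq a 0.
    exists 0, 1; split; rewrite ?oner_eq0 // ?a0 ?mul0r ?invr0 //.
      exact: (subalg0 hS).
    exact: (subalg1 hS).
  by exists c, a; rewrite invf_div.
Qed.

(** The weight is [-(3 i + j)] modulo [3 m], and [3 i + j] runs without repetition through
    [0, ..., 3 m - 1]. *)
Lemma weight_inj m d i j d' i' j' : (i < m)%N -> (i' < m)%N -> (j < 3)%N -> (j' < 3)%N ->
  (d * (3 * m) + i * (3 * m - 3) + j * (3 * m - 1) =
   d' * (3 * m) + i' * (3 * m - 3) + j' * (3 * m - 1))%N -> i = i' /\ j = j'.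
Proof.
have weight d1 i1 j1 : (0 < m)%N ->
    (d1 * (3 * m) + i1 * (3 * m - 3) + j1 * (3 * m - 1) + 3 * i1 + j1 = 3 * ((d1 + i1 + j1) * m))%N.
  case: m => // k _; have -> : (3 * k.+1 - 3 = 3 * k)%N by lia.
  have -> : (3 * k.+1 - 1 = 3 * k + 2)%N by lia.
  by lia.
move=> im i'm j3 j'3 e; have m0 : (0 < m)%N by lia.
have := weight d i j m0; have := weight d' i' j' m0; rewrite {}e.
set X := (d' + i' + j')%N; set Y := (d + i + j)%N.
move=> e1 e2; have jj : j = j' by lia.
have e3 : (X * m + i = Y * m + i')%N by lia.
have [l|l|l] := ltngtP X Y; last by rewrite l in e3; split=> //; lia.
all: by exfalso; nia.
Qed.

(** * The cubic cover of the Fermat curve at a zero of [x] *)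

Section FermatModel.
Variables (K : finFieldType) (F : fieldType) (iota : {rmorphism K -> F}).
Variables (m : nat) (x w y : F) (P : F -> int).
Hypothesis m1 : (1 < m)%N.
Hypothesis mK : m%:R != 0 :> K.
Hypothesis threeK : 3%:R != 0 :> K.
(** Makes [X ^ m + 1] divide [X ^ (#|K| - 1) - 1], so that all roots of [X ^ m = -1] lie in [K]. *)
Hypothesis cardK : exists k, (#|K|.-1 = m * k)%N /\ (-1) ^+ k = 1 :> K.
Hypothesis x0 : x != 0.
Hypothesis w0 : w != 0.
Hypothesis fermat : x ^+ m + w ^+ m + 1 = 0.
Hypothesis cubic : y ^+ 3 = x * w.
(** This is [F = K(x, y)], in a form that is easily carried through the changes of coordinates made
    later. *)
Hypothesis gen : forall S, subfield iota S -> S x -> S y -> forall z, S z.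
Hypothesis hP : is_place iota P.
Hypothesis Px : 0 < P x.

Let m0 : (0 < m)%N. Proof. exact: ltnW. Qed.

Lemma model_y_neq0 : y != 0.
Proof.
by apply: contraNneq (mulf_neq0 x0 w0) => y0; rewrite -cubic y0 expr0n.
Qed.
Let y0 := model_y_neq0.

Lemma vge_subX (Q : F -> int) i u v n : is_place iota Q -> vge Q 0 u -> vge Q 0 v ->
  vge Q i (u - v) -> vge Q i (u ^+ n - v ^+ n).
Proof.
move=> hQ Qu Qv Quv; elim: n => [|n IH]; first by rewrite !expr0 subrr; left.
have -> : u ^+ n.+1 - v ^+ n.+1 = u * (u ^+ n - v ^+ n) + v ^+ n * (u - v).
  by rewrite !exprS; ring.
have hS := vge_subalg hQ.
by apply: (vgeD hQ); rewrite -[i]add0r; apply: (vgeM hQ) => //; apply: (subalgX hS).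
Qed.

Lemma vge_w Q : is_place iota Q -> vge Q 0 x -> vge Q 0 w.
Proof.
move=> hQ Qx; apply: (vgeXE hQ m0); rewrite mulr0.
have -> : w ^+ m = - (x ^+ m + 1) by apply/eqP; rewrite -addr_eq0 addrCA addrA fermat.
have hS := vge_subalg hQ.
by apply/(vgeN hQ)/(vgeD hQ); [apply: (subalgX hS) | apply: (subalg1 hS)].
Qed.

Let Px1 : vge P 1 x. Proof. by right; lia. Qed.

(** If no [w - b] vanished at [P], all would be units there, and so would their product
    [w ^ #|K| - w]; but the latter is a multiple of [w ^ m + 1 = - x ^ m], which vanishes at [P]. *)
Lemma tangent_exists : exists b : K, b ^+ m = -1 /\ vge P 1 (w - iota b).
Proof.
have Pw : vge P 0 w by apply: vge_w => //; apply: vgeW Px1.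
have hS := vge_subalg hP.
have Pwm1 : vge P 1 (w ^+ m - -1).
  have -> : w ^+ m - -1 = - x ^+ m by apply/eqP; rewrite -addr_eq0 opprK addrC addrA fermat.
  by apply/(vgeN hP)/(vge1X hP).
have PN1 : vge P 0 (-1) by apply/(subalgN hS)/(subalg1 hS).
have [b Pb] : exists b : K, vge P 1 (w - iota b).
  apply: boolp.contrapT => nb.
  have unit c : w - iota c != 0 /\ P (w - iota c) = 0.
    have h : ~ vge P 1 (w - iota c) by move=> h; apply: nb; exists c.
    have wc0 : w - iota c != 0 by apply/eqP => wc; apply: h; left.
    split=> //; have /(vge_neq0 wc0) : vge P 0 (w - iota c) by apply: (subalgB hS) => //; apply: (subalgC hS).
    have : ~ 1 <= P (w - iota c) by move=> ?; apply: h; right.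
    by lia.
  have [k [ck sk]] := cardK.
  have cK : #|K| = (m * k).+1 by rewrite -ck prednK // (ltn_trans _ (finNzRing_gt1 K)).
  have Pz : vge P 1 (w ^+ #|K| - w).
    have -> : w ^+ #|K| - w = w * ((w ^+ m) ^+ k - (-1) ^+ k).
      have -> : (-1) ^+ k = 1 :> F by rewrite -(rmorphN1 iota) -rmorphXn sk rmorph1.
      by rewrite cK exprS exprM; ring.
    rewrite -[1]add0r; apply: (vgeM hP) => //; apply: vge_subX => //; exact: (subalgX hS).
  have eP : w ^+ #|K| - w = \prod_(c : K) (w - iota c).
    have := congr1 (fun g => (map_poly iota g).[w]) (finField_genPoly K).
    rewrite rmorphB /= map_polyXn map_polyX !hornerE => ->.
    rewrite rmorph_prod horner_prod; apply: eq_bigr => c _.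
    by rewrite rmorphB /= map_polyX map_polyC !hornerE.
  have [z0 z1] : w ^+ #|K| - w != 0 /\ P (w ^+ #|K| - w) = 0.
    rewrite eP; apply: (big_ind (fun u => u != 0 /\ P u = 0)) => //.
      by rewrite oner_eq0 (place1 hP).
    by move=> u v [u0 Pu] [v0 Pv]; rewrite mulf_neq0 // (placeM hP) // Pu Pv.
  by have := vge_neq0 z0 Pz; rewrite z1.
exists b; split=> //; apply/eqP; rewrite -subr_eq0 opprK; apply/eqP/(vge1_const hP).
have -> : iota (b ^+ m + 1) = (w ^+ m - -1) - (w ^+ m - iota b ^+ m).
  by rewrite rmorphD rmorphXn rmorph1; ring.
by apply: (vgeB hP) => //; apply: vge_subX => //; apply: (subalgC hS).
Qed.

(** * The local ring at [P], with uniformizer [y] *)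

Section Tangent.
Variables (b : K) (bm : b ^+ m = -1).
Local Notation s := (w - iota b).
Hypothesis Ps : vge P 1 s.

Lemma tangent_b_neq0 : b != 0.
Proof. by apply: contra_eq_neq bm => ->; rewrite expr0n -[m]prednK //= eq_sym oppr_eq0 oner_eq0. Qed.
Let b0 := tangent_b_neq0.

(* [residue z c]: z is a fraction in K[y, w - b] regular at (0, 0), with value c there. *)
Inductive residue : F -> K -> Prop :=
| residue_const c : residue (iota c) c
| residue_y : residue y 0
| residue_s : residue s 0
| residue_add z1 z2 c1 c2 : residue z1 c1 -> residue z2 c2 -> residue (z1 + z2) (c1 + c2)
| residue_mul z1 z2 c1 c2 : residue z1 c1 -> residue z2 c2 -> residue (z1 * z2) (c1 * c2)
| residue_inv z c : c != 0 -> residue z c -> residue z^-1 c^-1.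

Lemma residue_unit Q c z : is_place iota Q -> c != 0 -> vge Q 1 (z - iota c) ->
  z != 0 /\ Q z = 0.
Proof.
move=> hQ c0 h; have ic0 : iota c != 0 by rewrite fmorph_eq0.
have := place_addl hQ ic0; rewrite (placeC hQ) // => /(_ (z - iota c) h).
by rewrite addrC subrK.
Qed.

Lemma residue_place Q z c : is_place iota Q -> vge Q 1 y -> vge Q 1 s ->
  residue z c -> vge Q 1 (z - iota c).
Proof.
move=> hQ Qy Qs; have Q0 u d : vge Q 1 (u - iota d) -> vge Q 0 u.
  by rewrite -{2}(subrK (iota d) u) => h; apply: (vgeD hQ); [apply: vgeW h | apply: (vgeC hQ)].
elim=> {z c} [c|||z1 z2 c1 c2 _ h1 _ h2|z1 z2 c1 c2 _ h1 _ h2|z c c0 _ h].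
- by rewrite subrr; left.
- by rewrite rmorph0 subr0.
- by rewrite rmorph0 subr0.
- by rewrite rmorphD opprD addrACA; apply: (vgeD hQ).
- have -> : z1 * z2 - iota (c1 * c2) = z1 * (z2 - iota c2) + iota c2 * (z1 - iota c1).
    by rewrite rmorphM; ring.
  apply: (vgeD hQ); rewrite -[1]add0r; apply: (vgeM hQ) => //; first exact: Q0 h1.
  exact: (vgeC hQ).
- have [z0 Qz] := residue_unit hQ c0 h; have ic0 : iota c != 0 by rewrite fmorph_eq0.
  have -> : z^-1 - iota c^-1 = - iota c^-1 * z^-1 * (z - iota c).
    by rewrite fmorphV; field; rewrite ?z0 ?ic0.
  have hS := vge_subalg hQ.
  rewrite -[1]add0r; apply: (vgeM hQ) => //; apply: (subalgM hS).
    exact/(subalgN hS)/(subalgC hS).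
  by right; rewrite (placeV hQ) // Qz.
Qed.

Lemma Py1 : vge P 1 y.
Proof.
right; have := placeX hP 3 y0; rewrite cubic (placeM hP) //.
have Pw : vge P 0 w by apply: vge_w => //; apply: vgeW Px1.
have := vge_neq0 w0 Pw; lia.
Qed.

Lemma residue_w : residue w b.
Proof. by rewrite -(subrK (iota b) w) -[b in X in residue _ X]add0r; apply: residue_add (residue_s) (residue_const _). Qed.

Lemma residueX z c n : residue z c -> residue (z ^+ n) (c ^+ n).
Proof.
move=> h; elim: n => [|n IH]; last by rewrite !exprS; apply: residue_mul.
by rewrite !expr0 -(rmorph1 iota); apply: residue_const.
Qed.

Lemma residue_x : residue x 0.
Proof.
have -> : x = y * (y ^+ 2 / w) by rewrite mulrA -exprS cubic mulfK.
rewrite -(mul0r (0 ^+ 2 * b^-1)); apply: residue_mul (residue_y) _.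
apply: residue_mul (residueX _ residue_y) _.
exact: residue_inv b0 residue_w.
Qed.

Lemma residue_divw n : exists g, w ^+ n.+1 - iota b ^+ n.+1 = s * g /\ residue g (n.+1%:R * b ^+ n).
Proof.
elim: n => [|n [g [e hg]]].
  by exists 1; rewrite !expr1 mulr1 expr0 mulr1 -(rmorph1 iota); split=> //; apply: residue_const.
exists (w * g + iota (b ^+ n.+1)); split.
  have -> : w ^+ n.+2 - iota b ^+ n.+2 = w * (w ^+ n.+1 - iota b ^+ n.+1) + s * iota b ^+ n.+1.
    by rewrite [w ^+ n.+2]exprS [iota b ^+ n.+2]exprS; ring.
  by rewrite e rmorphXn; ring.
have -> : n.+2%:R * b ^+ n.+1 = b * (n.+1%:R * b ^+ n) + b ^+ n.+1.
  by rewrite -[n.+2]addn1 natrD exprS; ring.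
by apply: residue_add (residue_const _); apply: residue_mul residue_w hg.
Qed.

(** As [b ^ m = -1], the Fermat equation reads [x ^ m = -(w ^ m - b ^ m)], and the cofactor of
    [w - b] takes the derivative [m b ^ (m - 1)] at [P]. So the line [w = b] has contact of order
    [m] with the Fermat curve. *)
Lemma tangent_factor : exists g c, [/\ c != 0, residue g c & x ^+ m = - (s * g)].
Proof.
have [g [e hg]] := residue_divw m.-1; rewrite prednK // in e hg.
exists g, (m%:R * b ^+ m.-1); split=> //; first by rewrite mulf_neq0 // expf_neq0.
rewrite -e -rmorphXn bm rmorphN1 opprK; apply/eqP; rewrite -addr_eq0.
by rewrite addrA fermat.
Qed.

Lemma residue_neq0 z c : c != 0 -> residue z c -> z != 0.
Proof. by move=> c0 /(residue_place hP Py1 Ps)/(residue_unit hP c0)[]. Qed.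

Lemma tangent_neq0 : s != 0.
Proof.
have [g [c [c0 hg e]]] := tangent_factor.
by apply: contraNneq (expf_neq0 m x0) => s0; rewrite e s0 mul0r oppr0.
Qed.
Let s0 := tangent_neq0.

(** [y] generates the maximal ideal. The only generator to examine is [w - b], which
    [tangent_factor] expresses by [x], and [x = y ^ 3 / w]. *)
Lemma residue_y_expansion z c : residue z c -> exists z' c', residue z' c' /\ z = iota c + y * z'.
Proof.
have r0 : residue 0 0 by rewrite -{1}(rmorph0 iota); apply: residue_const.
have r1 : residue 1 1 by rewrite -{1}(rmorph1 iota); apply: residue_const.
elim=> {z c} [c|||z1 z2 c1 c2 _ [u1 [d1 [h1 e1]]] _ [u2 [d2 [h2 e2]]]
  |z1 z2 c1 c2 _ [u1 [d1 [h1 e1]]] hz2 [u2 [d2 [h2 e2]]]|z c c0 hz [u [d [h e]]]].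
- by exists 0, 0; rewrite mulr0 addr0.
- by exists 1, 1; rewrite mulr1 rmorph0 add0r.
- have [g [c [c0 hg e]]] := tangent_factor.
  have g0 := residue_neq0 c0 hg.
  (* The witness is [(w - b) / y], from [w - b = - x ^ m / g] with one factor [x] replaced by
     [y ^ 3 / w]. *)
  exists (iota (-1) * (y ^+ 2 * w^-1) * x ^+ m.-1 * g^-1), (-1 * (0 ^+ 2 * b^-1) * 0 ^+ m.-1 * c^-1); split.
    apply: residue_mul (residue_inv c0 hg); apply: residue_mul (residueX _ residue_x).
    apply: residue_mul (residue_const _) _.
    exact: residue_mul (residueX _ residue_y) (residue_inv b0 residue_w).
  rewrite rmorph0 add0r rmorphN1; apply: (mulIf g0).
  have -> : y * (-1 * (y ^+ 2 * w^-1) * x ^+ m.-1 * g^-1) * g = - (y ^+ 3 / w * x ^+ m.-1).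
    by rewrite !exprS expr0; field; rewrite ?w0 ?g0.
  by rewrite cubic mulfK // -exprS prednK // e opprK.
- by exists (u1 + u2), (d1 + d2); split; [apply: residue_add | rewrite e1 e2 rmorphD; ring].
- exists (u1 * z2 + iota c1 * u2), (d1 * c2 + c1 * d2); split.
    by apply: residue_add; apply: residue_mul => //; apply: residue_const.
  by rewrite e1 mulrDl -mulrA {1}e2 rmorphM; ring.
- have z0 := residue_neq0 c0 hz; have ic0 : iota c != 0 by rewrite fmorph_eq0.
  exists (iota (- c^-1) * u * z^-1), (- c^-1 * d * c^-1); split.
    by apply: residue_mul (residue_inv c0 hz); apply: residue_mul h; apply: residue_const.
  have eu : y * u = z - iota c by rewrite e addrC addKr.
  have -> : y * (iota (- c^-1) * u * z^-1) = iota (- c^-1) * (y * u) * z^-1 by ring.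
  by rewrite eu rmorphN fmorphV; field; rewrite ?z0 ?ic0.
Qed.

Definition place_ring z := exists c, residue z c.
Local Notation L := place_ring.

Lemma place_ring_subalg : subalg iota L.
Proof.
split=> [c|z1 z2 [c1 h1] [c2 h2]|z1 z2 [c1 h1] [c2 h2]].
- by exists c; apply: residue_const.
- by exists (c1 + c2); apply: residue_add.
- by exists (c1 * c2); apply: residue_mul.
Qed.

Lemma place_ring_ge0 Q : is_place iota Q -> vge Q 1 y -> vge Q 1 s ->
  forall z, L z -> vge Q 0 z.
Proof.
move=> hQ Qy Qs z [c h]; rewrite -(subrK (iota c) z); apply: (vgeD hQ); last exact: (vgeC hQ).
exact: vgeW (residue_place hQ Qy Qs h).
Qed.

Lemma place_ring_step z : z != 0 -> L z -> L z^-1 \/ L (z / y).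
Proof.
move=> z0 [c h]; have [c0|c0] := eqVneq c 0.
  have [z' [c' [h' e]]] := residue_y_expansion h; right; exists c'.
  by rewrite e c0 rmorph0 add0r mulrC mulKf.
by left; exists c^-1; apply: residue_inv.
Qed.

Lemma place_ring_frac z : exists a c, [/\ L a, L c, c != 0 & z = a / c].
Proof.
have hL := place_ring_subalg.
have sub u c : residue u c -> exists a d, [/\ L a, L d, d != 0 & u = a / d].
  by move=> h; exists u, 1; split; rewrite ?oner_eq0 ?divr1 //; [exists c | apply: (subalg1 hL)].
apply: (gen (fractions_subfield hL)); first exact: sub residue_x.
exact: sub residue_y.
Qed.

Let PL := place_ring_ge0 hP Py1 Ps.

Lemma place_ring_fin z : z != 0 -> L z -> exists n, ~ L (z / y ^+ n).
Proof.
move=> z0 _; exists (`|P z|%N.+1) => /PL h.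
have yn0 : y ^+ `|P z|%N.+1 != 0 by rewrite expf_neq0.
have zy0 : z / y ^+ `|P z|%N.+1 != 0 by rewrite mulf_neq0 ?invr_neq0.
have := vge_neq0 zy0 h; rewrite (placeM hP) ?invr_neq0 // (placeV hP) // (placeX hP) //.
have := vge_neq0 y0 Py1; nia.
Qed.

Lemma place_y : P y = 1.
Proof.
exact: (dominating_place_uniformizer place_ring_subalg y0 place_ring_step
  place_ring_fin place_ring_frac hP PL Py1).
Qed.

(** Both places dominate the discrete valuation ring [place_ring], which determines them. *)
Lemma place_at_tangent Q : is_place iota Q -> vge Q 1 y -> vge Q 1 s -> same_place Q P.
Proof.
move=> hQ Qy Qs; apply: (dominating_place_uniq place_ring_subalg y0 place_ring_step
  place_ring_fin place_ring_frac) => //; last exact: Py1.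
exact: place_ring_ge0.
Qed.

Lemma place_tangent : P s = (3 * m)%:Z.
Proof.
have [g [c [c0 hg e]]] := tangent_factor.
have [g0 Pg] := residue_unit hP c0 (residue_place hP Py1 Ps hg).
have [_ Pw] := residue_unit hP b0 (residue_place hP Py1 Ps residue_w).
have := placeX hP m x0; rewrite e (placeN hP) ?mulf_neq0 // (placeM hP) // Pg.
have := placeX hP 3 y0; rewrite cubic (placeM hP) // Pw place_y; lia.
Qed.

Lemma place_x : P x = 3.
Proof.
have [_ Pw] := residue_unit hP b0 (residue_place hP Py1 Ps residue_w).
have := placeX hP 3 y0; rewrite cubic (placeM hP) // Pw place_y; lia.
Qed.

(** * Functions with poles only at [P], and their pole orders *)

Local Notation al := (x / s).
Local Notation be := (y / s).
Local Notation ga := (s^-1).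
Local Notation A := (affine_ring iota al be ga).

Lemma model_W : 1 + iota b * ga = w / s.
Proof. by rewrite -(divff s0) -mulrDl subrK. Qed.

Lemma model_fermat : al ^+ m + (1 + iota b * ga) ^+ m + ga ^+ m = 0.
Proof.
rewrite model_W !expr_div_n exprVn -[X in _ + X]mul1r -!mulrDl fermat mul0r //.
Qed.

Lemma model_cubic : be ^+ 3 = al * (1 + iota b * ga) * ga.
Proof. by rewrite model_W expr_div_n cubic; field. Qed.

Let al0 : al != 0. Proof. by rewrite mulf_neq0 ?invr_neq0. Qed.
Let be0 : be != 0. Proof. by rewrite mulf_neq0 ?invr_neq0. Qed.
Let ga0 : ga != 0. Proof. by rewrite invr_neq0. Qed.

Lemma place_al : P al = 3 - (3 * m)%:Z.
Proof. by rewrite (placeM hP) ?invr_neq0 // (placeV hP) // place_x place_tangent. Qed.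

Lemma place_be : P be = 1 - (3 * m)%:Z.
Proof. by rewrite (placeM hP) ?invr_neq0 // (placeV hP) // place_y place_tangent. Qed.

Lemma place_ga : P ga = - (3 * m)%:Z.
Proof. by rewrite (placeV hP) // place_tangent. Qed.

Let Agens : [/\ A al, A be & A ga] := affine_gens iota al be ga.

Lemma model_affine_frac z : exists a c, [/\ A a, A c, c != 0 & z = a / c].
Proof.
have [Aal Abe Aga] := Agens.
apply: (gen (fractions_subfield (affine_subalg iota al be ga))).
  by exists al, ga; split; rewrite // invrK divfK.
by exists be, ga; split; rewrite // invrK divfK.
Qed.

(** A pole of [ga] at [Q] is a zero of [w - b], which forces zeros of [x] and [y], so [Q] is [P].
    Elsewhere [ga] is regular, and [al], [be] are integral over [K[ga]]. *)
Lemma affine_ge0 Q : is_place iota Q -> ~ same_place Q P -> forall z, A z -> vge Q 0 z.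
Proof.
move=> hQ nQP; have hS := vge_subalg hQ.
have Qga : vge Q 0 ga.
  right; rewrite leNgt; apply/negP => Qga; apply: nQP.
  have Qs : vge Q 1 s.
    by right; move: Qga; rewrite (placeV hQ) //; lia.
  have [w0' Qw] := residue_unit hQ b0 Qs.
  have Qx : vge Q 1 x.
    have Qxm : vge Q 1 (x ^+ m).
      have -> : x ^+ m = - (w ^+ m - iota b ^+ m).
        by rewrite -rmorphXn bm rmorphN1 opprK; apply/eqP; rewrite -addr_eq0 addrA fermat.
      apply/(vgeN hQ)/vge_subX => //; first by right; rewrite Qw.
      exact: (vgeC hQ).
    right; have := vge_neq0 (expf_neq0 m x0) Qxm; rewrite (placeX hQ) //; nia.
  apply: place_at_tangent => //; right.
  have := placeX hQ 3 y0; rewrite cubic (placeM hQ) // Qw.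
  have := vge_neq0 x0 Qx; lia.
have QW : vge Q 0 (1 + iota b * ga).
  apply: (vgeD hQ); first exact: (subalg1 hS).
  by apply: (subalgM hS) => //; apply: (subalgC hS).
have Qal : vge Q 0 al.
  apply: (vgeXE hQ m0); rewrite mulr0.
  have -> : al ^+ m = - ((1 + iota b * ga) ^+ m + ga ^+ m).
    by apply/eqP; rewrite -addr_eq0 addrA model_fermat.
  by apply/(vgeN hQ)/(vgeD hQ); apply: (subalgX hS).
apply: affine_min => //; apply: (vgeXE hQ (n := 3)) => //; rewrite mulr0 model_cubic.
by apply: (subalgM hS) => //; apply: (subalgM hS).
Qed.

Lemma place_monomial g i j : g != 0 ->
  ev iota ga g * (al ^+ i * be ^+ j) != 0 /\
  P (ev iota ga g * (al ^+ i * be ^+ j)) =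
    - ((size g).-1 * (3 * m) + i * (3 * m - 3) + j * (3 * m - 1))%N%:Z.
Proof.
move=> g0; have Pga : P ga < 0 by rewrite place_ga; lia.
have [ev0 Pev] := place_horner hP ga0 Pga g0; rewrite -evE in ev0 Pev.
have ai0 : al ^+ i != 0 by rewrite expf_neq0.
have bj0 : be ^+ j != 0 by rewrite expf_neq0.
split; first by rewrite !mulf_neq0.
rewrite (placeM hP) ?mulf_neq0 // (placeM hP) // Pev !(placeX hP) // place_al place_be place_ga.
have e1 : (3 * m - 3)%N%:Z = (3 * m)%N%:Z - 3 by lia.
have e2 : (3 * m - 1)%N%:Z = (3 * m)%N%:Z - 1 by lia.
by rewrite !PoszD 2!(PoszM _ (3 * m - _)%N) (PoszM _ (3 * m)%N) e1 e2; ring.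
Qed.

(** The monomials of the normal form have distinct orders by [weight_inj], so [z] has the order of
    one of them; the degree of its coefficient in [ga] counts the generator [3 m]. *)
Lemma affine_place z : z != 0 -> A z ->
  exists a c d : nat, P z = - (a * (3 * m - 3) + c * (3 * m - 1) + d * (3 * m))%N%:Z.
Proof.
move=> z0 Az; have [h ez] := affine_normal_form m0 model_fermat model_cubic Az.
have term ij : ev iota ga (h ij) * (al ^+ ij.1 * be ^+ ij.2) != 0 -> h ij != 0.
  by apply: contraNneq => ->; rewrite rmorph0 mul0r.
have [|e|[[i j] [_ /term hij e]]] := place_sum_distinct hP
    (f := fun ij => ev iota ga (h ij) * (al ^+ ij.1 * be ^+ ij.2)) (index_enum_uniq _).
- move=> [i j] [i' j'] _ _ /term hij /term hij'.
  have [_ ->] := place_monomial i j hij; have [_ ->] := place_monomial i' j' hij'.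
  have [im i'm] := (ltn_ord i, ltn_ord i'); have [j3 j'3] := (ltn_ord j, ltn_ord j').
  move=> /oppr_inj [/weight_inj] [] // ei ej.
  by congr pair; apply: val_inj.
- by rewrite ez /normal_form e eqxx in z0.
- exists i, j, (size (h (i, j))).-1; rewrite ez /normal_form e /=.
  by have [_ ->] := place_monomial i j hij; rewrite -addnA addnC.
Qed.

Lemma tangent_semigroup n :
  in_weierstrass iota P n <-> in_semigroup3 (3 * m - 3) (3 * m - 1) (3 * m) n.
Proof.
have [Aal Abe Aga] := Agens; have hA := affine_subalg iota al be ga.
split=> [[f [f0 Pf reg]]|[a [c [d ->]]]].
  suff Af : A f by have [a [c [d e]]] := affine_place f0 Af; exists a, c, d; lia.
  apply: boolp.contrapT => nAf.
  (* [Q] is nonnegative on [ga], which has a pole at [P]; so this pole of [f] lies off [P]. *)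
  have [Q [hQ QA]] := affine_pole m0 model_fermat model_cubic b0 mK threeK model_affine_frac f0 nAf.
  rewrite ltNge => /negP; apply; apply: reg => // QP.
  have := vge_neq0 ga0 (QA _ Aga); rewrite QP // place_ga; lia.
exists (al ^+ a * be ^+ c * ga ^+ d); split.
- by rewrite !mulf_neq0 ?expf_neq0.
- rewrite !(placeM hP) ?mulf_neq0 ?expf_neq0 // !(placeX hP) // place_al place_be place_ga.
  have e1 : (3 * m - 3)%N%:Z = (3 * m)%N%:Z - 3 by lia.
  have e2 : (3 * m - 1)%N%:Z = (3 * m)%N%:Z - 1 by lia.
  by rewrite !PoszD 2!(PoszM _ (3 * m - _)%N) (PoszM _ (3 * m)%N) e1 e2; ring.
- move=> Q hQ nQP; apply: vge_neq0; first by rewrite !mulf_neq0 ?expf_neq0.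
  apply: (affine_ge0 hQ nQP); apply: affine_mul; first apply: affine_mul.
  all: exact: (subalgX hA).
Qed.

End Tangent.

Lemma model_semigroup n :
  in_weierstrass iota P n <-> in_semigroup3 (3 * m - 3) (3 * m - 1) (3 * m) n.
Proof. by have [b [bm Pb]] := tangent_exists; apply: (tangent_semigroup bm). Qed.

End FermatModel.

(** * Transfer from the curve to the Fermat model *)

Lemma eval2_subalg (K F : fieldType) (iota : {rmorphism K -> F}) (S : F -> Prop)
    (B : {poly {poly K}}) x y : subalg iota S -> S x -> S y -> S (eval2 iota B x y).
Proof.
move=> hS Sx Sy; rewrite /eval2; elim/big_ind: _ => [|u v|].
- exact: (subalg0 hS).
- exact: (subalgD hS).
- by move=> i _; apply: (subalgM hS); [apply: (subalg_horner hS) | apply: (subalgX hS)].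
Qed.

Lemma natr_card_eq0 (K : finFieldType) (q : nat) : #|K| = (q ^ 2)%N -> q%:R = 0 :> K.
Proof.
move=> cK; have [p p_pr pK] := finPcharP K.
have cp : #|K| = (p ^ logn p #|K|)%N by exact: (card_pprimeChar pK).
have lp : (0 < logn p #|K|)%N.
  by rewrite lt0n; apply: contraTneq (finNzRing_gt1 K) => l0; rewrite cp l0.
apply/eqP; rewrite -(dvdn_pcharf pK).
suff : (p %| q ^ 2)%N by rewrite Euclid_dvdX // => /andP[].
by rewrite -cK cp dvdn_exp.
Qed.

Theorem theorem4p2 (p k q : nat) (K : finFieldType) (F : fieldType)
    (iota : {rmorphism K -> F}) (x y : F) (P : F -> int) :
  prime p -> (0 < k)%N -> q = (p ^ k)%N -> (5 <= q)%N -> (q %% 3 = 2)%N ->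
  #|K| = (q ^ 2)%N ->
  is_X3_function_field iota q x y ->
  is_place iota P -> in_O iota q x y P ->
  forall n : nat, in_weierstrass iota P n <-> in_semigroup3 (q - 2) q (q + 1) n.
Proof.
move=> _ _ _ q5 q3 cK; rewrite /is_X3_function_field /in_O.
set m := ((q + 1) %/ 3)%N => -[curve trx genxy] hP inO.
have qE : (q + 1 = 3 * m)%N by rewrite /m; lia.
have m1 : (1 < m)%N by lia.
have m0 : (0 < m)%N by lia.
have q0 := natr_card_eq0 cK.
(* [q] vanishes in [K], so [3 m = q + 1] equals 1 there and both factors are invertible. *)
have m3K : 3%:R * m%:R = 1 :> K by rewrite -natrM -qE natrD q0 add0r.
have threeK : 3%:R != 0 :> K by apply: contra_eq_neq m3K => ->; rewrite mul0r eq_sym oner_eq0.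
have mK : m%:R != 0 :> K by apply: contra_eq_neq m3K => ->; rewrite mulr0 eq_sym oner_eq0.
have cardK : exists k, (#|K|.-1 = m * k)%N /\ (-1) ^+ k = 1 :> K.
  (* [q ^ 2 - 1] is [m] times [3 (q - 1)]; this exponent is even for odd [q], while for even [q] the
     characteristic is 2 and [-1 = 1]. *)
  exists (3 * (q - 1))%N; split; first by rewrite cK; nia.
  have [oq|eq] := boolP (odd q).
    by rewrite -signr_odd oddM oddB ?oq //; lia.
  have N1 : (-1 : K) = 1.
    by rewrite -[LHS]expf_card cK -signr_odd oddX (negPf eq).
  by rewrite N1 expr1n.
have x0 : x != 0.
  by have := trx 'X (negbT (polyX_eq0 K)); rewrite map_polyX hornerX.
have xm1 : x ^+ m + 1 != 0.
  have Xm : 'X^m + 1%:P != 0 :> {poly K} by rewrite monic_neq0 // monicXnaddC.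
  by have := trx _ Xm; rewrite rmorphD rmorphXn rmorph1 /= map_polyX !hornerE.
have y0 : y != 0.
  apply: contraNneq (mulf_neq0 (expf_neq0 m x0) xm1) => y0.
  by move: curve; rewrite y0 addn1 expr0n /= add0r mul2n -addnn exprD mulrDr mulr1 => ->.
set w := y ^+ 3 / x.
have w0 : w != 0 by rewrite mulf_neq0 ?expf_neq0 ?invr_neq0.
(* Since [y ^ (q + 1) = (y ^ 3) ^ m = x ^ m w ^ m], this is the curve equation divided by
   [x ^ m]. *)
have fermat : x ^+ m + w ^+ m + 1 = 0.
  have xm0 : x ^+ m != 0 by rewrite expf_neq0.
  apply: (mulIf xm0); rewrite mul0r -curve qE exprM mul2n -addnn exprD.
  by rewrite /w expr_div_n; field.
have cubic : y ^+ 3 = x * w by rewrite /w mulrC divfK.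
have gen S : subfield iota S -> S x -> S y -> forall z, S z.
  move=> hS Sx Sy z; have [A [B [_ ->]]] := genxy z; have [hA _] := hS.
  by apply: (subfield_div hS); apply: eval2_subalg.
have -> : (q - 2 = 3 * m - 3)%N by lia.
have -> : q = (3 * m - 1)%N by lia.
have -> : (3 * m - 1 + 1 = 3 * m)%N by lia.
case: inO => [Px|Px|[a [am [Pxa Py]]]].
- exact: (model_semigroup m1 mK threeK cardK x0 w0 fermat cubic gen hP Px).
(* At a pole of [x]: sending [x], [w], [y] to [1 / x], [w / x], [y / x] preserves both equations and
   exchanges zeros and poles of [x]. *)
- have xi0 : x^-1 != 0 by rewrite invr_neq0.
  have wx0 : w / x != 0 by rewrite mulf_neq0.
  apply: (@model_semigroup K F iota m x^-1 (w / x) (y / x)) => //.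
  + rewrite exprVn expr_div_n; apply: (mulIf (expf_neq0 m x0)).
    by rewrite mul0r -fermat; field; rewrite expf_neq0.
  + by rewrite expr_div_n cubic; field.
  + move=> S hS Sx Sy; have [hA SV] := hS; have Sx' : S x by rewrite -[x]invrK; apply: SV.
    by apply: gen => //; rewrite -(divfK x0 y); apply: (subalgM hA).
  + by rewrite (placeV hP) //; lia.
(* The equations are symmetric in [x] and [w]. Here [x] takes the nonzero value [a] and [y]
   vanishes, so [y ^ 3 = x w] makes [w] vanish. *)
- apply: (@model_semigroup K F iota m w x y) => //.
  + by rewrite [w ^+ m + _]addrC.
  + by rewrite cubic mulrC.
  + move=> S hS Sw Sy; have [hA SV] := hS; apply: gen => //.
    have -> : x = y ^+ 3 / w by rewrite cubic mulfK.
    by apply: (subfield_div hS) => //; apply: (subalgX hA).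
  + have a0 : a != 0.
      by apply: contra_eq_neq am => ->; rewrite expr0n -[m]prednK //= eq_sym oppr_eq0 oner_eq0.
    have [_ Px0] : x != 0 /\ P x = 0 by apply: (residue_unit hP a0); right; rewrite -gtz0_ge1.
    have := placeX hP 3 y0; rewrite cubic (placeM hP) // Px0; lia.
Qed.
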